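(* Let $\Bbbk$ be a commutative ring with unit, let $\phi: G \to G'$ be a morphism of groups, and let $A$ be a noetherian $G$-graded $\Bbbk$-algebra. Let $n$ be the projective dimension of $\Bbbk G'$ in the category ${}_{\Bbbk G}\mathsf{Mod}^{\Bbbk G'}$ of $G'$-graded left $\Bbbk G$-modules. If $I$ is an injective object in the category ${}_A\mathsf{Mod}^{\Bbbk G}$ of $G$-graded left $A$-modules, then the injective dimension of $\phi_!(I)$ in the category ${}_A\mathsf{Mod}^{\Bbbk G'}$ of $G'$-graded left $A$-modules is less than or equal to $n$.
   Context: Standing assumption: $A$ is projective as a $\Bbbk$-module. A $G$-graded algebra is $A=\bigoplus_{g\in G}A_g$ with $A_gA_{g'}\subseteq A_{gg'}$; a $G$-graded left $A$-module is a left $A$-module $M=\bigoplus_{g\in G}M_g$ with $A_gM_{g'}\subseteq M_{gg'}$. Morphisms in ${}_A\mathsf{Mod}^{\Bbbk G}$ are the $A$-linear maps $f$ with $f(M_g)\subseteq N_g$ for all $g$. The morphism $\phi$ induces a $G'$-grading on $A$ by $A_h=\bigoplus_{g\in\phi^{-1}(h)}A_g$ for $h\in G'$, and ${}_A\mathsf{Mod}^{\Bbbk G'}$ is the category of graded left modules for this $G'$-grading. The exact functor $\phi_!:{}_A\mathsf{Mod}^{\Bbbk G}\to{}_A\mathsf{Mod}^{\Bbbk G'}$ sends $M$ to the same $A$-module with $G'$-grading $\phi_!(M)_h=\bigoplus_{g\in\phi^{-1}(h)}M_g$, and is the identity on underlying maps. The group algebra $\Bbbk G$ is $G$-graded with $(\Bbbk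 G)_g=\Bbbk u_g$, where $u_g$ is the basis element corresponding to $g$, and is viewed as a $G'$-graded algebra through $\phi$ in the same way. The object $\Bbbk G'$ of ${}_{\Bbbk G}\mathsf{Mod}^{\Bbbk G'}$ has its natural $G'$-grading and the $\Bbbk G$-action $u_g\cdot u_h=u_{\phi(g)h}$. *)

(* Defs.v *)
From HB Require Import structures.
From mathcomp Require Import all_boot all_algebra finmap.
From mathcomp Require Import boolp classical_sets monalg.

Set Implicit Arguments.
Unset Strict Implicit.
Unset Printing Implicit Defensive.

Import GRing.Theory.
Local Open Scope ring_scope.
Local Open Scope classical_set_scope.

(* An associative unital k-algebra, given by a central structure morphism.     *)
(* MathComp's algType is not used because it excludes the zero ring.           *)
Record kAlgebra (k : comPzRingType) : Type := KAlgebra {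
  kalg_sort :> pzRingType;
  kalg_map : {rmorphism k -> kalg_sort};
  kalg_central : forall c x, kalg_map c * x = x * kalg_map c
}.

Definition kmodule (k : comPzRingType) (A : kAlgebra k) : Type := A.

Section KModule.
Variables (k : comPzRingType) (A : kAlgebra k).

HB.instance Definition _ := GRing.Zmodule.copy (kmodule A) (kalg_sort A).

Definition kmodule_scale (c : k) (x : kmodule A) : kmodule A :=
  (kalg_map A c * x)%R.

Lemma kmodule_scaleA c d x :
  kmodule_scale c (kmodule_scale d x) = kmodule_scale (c * d) x.
Proof. by rewrite /kmodule_scale rmorphM mulrA. Qed.

Lemma kmodule_scale1 : left_id 1 kmodule_scale.
Proof. by move=> x; rewrite /kmodule_scale rmorph1 mul1r. Qed.

Lemma kmodule_scaleDr : right_distributive kmodule_scale +%R.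
Proof. by move=> c x y; apply: mulrDr. Qed.

Lemma kmodule_scaleDl x : {morph kmodule_scale^~ x : c d / c + d}.
Proof. by move=> c d; rewrite /kmodule_scale rmorphD; apply: mulrDl. Qed.

HB.instance Definition _ := GRing.Zmodule_isLmodule.Build k (kmodule A)
  kmodule_scaleA kmodule_scale1 kmodule_scaleDr kmodule_scaleDl.

End KModule.

Section RingConditions.

Definition projective_module (R : pzRingType) (P : lmodType R) : Prop :=
  forall (M N : lmodType R) (f : {linear M -> N}) (u : {linear P -> N}),
    (forall y, exists x, f x = y) ->
    exists v : {linear P -> M}, forall x, f (v x) = u x.

Variable A : pzRingType.

Definition subgroup_closed (V : zmodType) (S : set V) : Prop :=
  S 0 /\ forall x y, S x -> S y -> S (x - y).

Definition left_ideal (J : set A) : Prop :=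
  subgroup_closed J /\ forall a x, J x -> J (a * x).

Definition right_ideal (J : set A) : Prop :=
  subgroup_closed J /\ forall a x, J x -> J (x * a).

Definition ascending_chain_condition (P : set A -> Prop) : Prop :=
  forall J : nat -> set A,
    (forall n, P (J n)) -> (forall n, J n `<=` J n.+1) ->
    exists N, forall n, (N <= n)%N -> J n = J N.

Definition noetherian : Prop :=
  ascending_chain_condition left_ideal /\ ascending_chain_condition right_ideal.

End RingConditions.

Section DirectSum.
Variables (I : choiceType) (V : zmodType) (V_ : I -> set V).

(* The sum of the subgroups V_ i over the indices i satisfying P. *)
Definition internal_sum (P : set I) : set V :=
  [set x | exists (s : seq I) (c : I -> V),
     [/\ uniq s, forall i, i \in s -> P i, forall i, V_ i (c i)
       & x = \sum_(i <- s) c i]].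

Definition internal_direct_sum : Prop :=
  [/\ forall i, subgroup_closed (V_ i),
      forall x, internal_sum setT x
    & forall (s : seq I) (c : I -> V), uniq s -> (forall i, V_ i (c i)) ->
        \sum_(i <- s) c i = 0 -> forall i, i \in s -> c i = 0].

End DirectSum.

(* The regrading V_h = \bigoplus_(g in phi^-1(h)) V_g. *)
Definition push_pieces (I J : choiceType) (phi : I -> J) (V : zmodType)
    (V_ : I -> set V) (h : J) : set V :=
  internal_sum V_ [set g | phi g = h].

Section DirectSumTheory.
Variables (I J : choiceType) (phi : I -> J) (V : zmodType) (V_ : I -> set V).
Hypothesis V_sub : forall i, subgroup_closed (V_ i).

Lemma big_uniq_widen (s u : seq I) (c : I -> V) :
  uniq s -> uniq u -> {subset s <= u} ->
  \sum_(i <- s) c i = \sum_(i <- u) (if i \in s then c i else 0).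
Proof.
move=> us uu sub; rewrite -big_mkcond -big_filter; apply: perm_big.
apply: uniq_perm; rewrite ?filter_uniq // => i.
by rewrite mem_filter; case: (boolP (i \in s)) => // /sub ->.
Qed.

Lemma internal_sum_sub (P : set I) : subgroup_closed (internal_sum V_ P).
Proof.
split=> [|x y].
  exists [::], (fun=> 0); split=> //; first by move=> i; have [] := V_sub i.
  by rewrite big_nil.
move=> [s [c [us sP cV ->]]] [t [d [ut tP dV ->]]].
set u := undup (s ++ t).
have uu : uniq u by rewrite undup_uniq.
exists u, (fun i => (if i \in s then c i else 0) - (if i \in t then d i else 0)).
split=> //.
- by move=> i; rewrite mem_undup mem_cat => /orP[/sP|/tP].
- move=> i; have [V0 VB] := V_sub i.
  by apply: VB; case: ifP.
rewrite sumrB (@big_uniq_widen s u) ?(@big_uniq_widen t u) //.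
  by move=> i it; rewrite mem_undup mem_cat it orbT.
by move=> i it; rewrite mem_undup mem_cat it.
Qed.

Lemma subgroup_sum (S : set V) (T : eqType) (s : seq T) (F : T -> V) :
  subgroup_closed S -> (forall i, i \in s -> S (F i)) ->
  S (\sum_(i <- s) F i).
Proof.
move=> [S0 SB] SF; rewrite big_seq; elim/big_ind: _ => //.
move=> x y Sx Sy; rewrite -[y]opprK -[- y]add0r.
by apply: (SB) => //; apply: SB.
Qed.

Lemma internal_sum1 (P : set I) i x : P i -> V_ i x -> internal_sum V_ P x.
Proof.
move=> Pi Vx; exists [:: i], (fun j => if j == i then x else 0); split=> //.
- by move=> j; rewrite inE => /eqP ->.
- by move=> j; case: eqP => [->//|_]; have [] := V_sub j.
by rewrite big_seq1 eqxx.
Qed.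

Lemma push_direct_sum :
  internal_direct_sum V_ -> internal_direct_sum (push_pieces phi V_).
Proof.
move=> [_ Vspan Vind]; split=> [h|x|t d ut dV sd0].
- exact: internal_sum_sub.
- have [s [c [us _ cV ->]]] := Vspan x.
  exists (undup (map phi s)), (fun h => \sum_(g <- s | phi g == h) c g).
  split=> //; first by rewrite undup_uniq.
    move=> h; rewrite -big_filter; apply: subgroup_sum.
      exact: internal_sum_sub.
    move=> g; rewrite mem_filter => /andP[/eqP gh _].
    exact: (internal_sum1 (i := g)).
  under [RHS]eq_bigr => h _ do rewrite big_mkcond.
  rewrite exchange_big /= big_seq [RHS]big_seq; apply: eq_bigr => g gs.
  have ins : phi g \in undup (map phi s) by rewrite mem_undup map_f.
  rewrite (bigD1_seq (phi g)) ?undup_uniq //= eqxx big1 ?addr0 // => h.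
  by rewrite eq_sym => /negbTE ->.
have /choice[s /choice[c sc]] : forall h, exists s, exists c : I -> V,
    [/\ uniq s, forall g, g \in s -> phi g = h, forall g, V_ g (c g)
      & d h = \sum_(g <- s) c g] by move=> h; exact: (dV h).
pose e g := c (phi g) g.
have deE h : d h = \sum_(g <- s h) e g.
  have [_ sh _ ->] := sc h.
  by rewrite big_seq [RHS]big_seq; apply: eq_bigr => g /sh; rewrite /e => ->.
pose S := [seq g | h <- t, g <- s h].
have uS : uniq S.
  apply: allpairs_uniq_dep => // [h _|]; first by have [] := sc h.
  move=> [h1 g1] [h2 g2] /allpairsPdep[h [g [_ gs ->]]].
  move=> /allpairsPdep[h' [g' [_ gs' ->]]] /= gg'; rewrite -{}gg' in gs' *.
  by have [_ /(_ _ gs) <- _ _] := sc h; have [_ /(_ _ gs') <- _ _] := sc h'.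
have e0 : \sum_(g <- S) e g = 0.
  rewrite big_allpairs_dep; apply: etrans sd0; apply: eq_bigr => h _.
  by rewrite deE.
have eV g : V_ g (e g) by have [] := sc (phi g).
move=> h ht; rewrite deE big_seq big1 // => g gs.
by apply: (Vind S) => //; apply/allpairsPdep; exists h, g.
Qed.

End DirectSumTheory.

Section GradedAlgebras.
Variables (k : comPzRingType) (G : groupType).

Record grAlg : Type := GrAlg {
  gralg_sort :> kAlgebra k;
  gralg_piece : G -> set gralg_sort;
  gralg_sum : internal_direct_sum gralg_piece;
  gralg_scale : forall g (c : k) x,
    gralg_piece g x -> gralg_piece g (kalg_map gralg_sort c * x);
  gralg_mul : forall g g' x y,
    gralg_piece g x -> gralg_piece g' y -> gralg_piece (g * g')%g (x * y)
}.

(* The pieces of a graded module are required to be additive subgroups only:   *)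
(* they are k-submodules since k acts through the degree 1 part of A.          *)
Record grMod (A : grAlg) : Type := GrMod {
  grmod_sort :> lmodType A;
  grmod_piece : G -> set grmod_sort;
  grmod_sum : internal_direct_sum grmod_piece;
  grmod_scale : forall g g' (a : A) x,
    gralg_piece g a -> grmod_piece g' x -> grmod_piece (g * g')%g (a *: x)
}.

Variable A : grAlg.

Record grHom (M N : grMod A) : Type := GrHom {
  grhom_fun :> {linear M -> N};
  grhom_piece : forall g x, grmod_piece g x -> grmod_piece g (grhom_fun x)
}.

(* The monomorphisms and epimorphisms of graded modules are the injective and  *)
(* surjective morphisms.                                                       *)
Definition gr_injective (E : grMod A) : Prop :=
  forall (M N : grMod A) (f : grHom M N) (u : grHom M E),
    injective f -> exists v : grHom N E, forall x, v (f x) = u x.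

Definition gr_projective (P : grMod A) : Prop :=
  forall (M N : grMod A) (f : grHom M N) (u : grHom P N),
    (forall y, exists x, f x = y) ->
    exists v : grHom P M, forall x, f (v x) = u x.

Definition exact_at (L M N : grMod A) (f : grHom L M) (g : grHom M N) : Prop :=
  forall y, g y = 0 <-> exists x, f x = y.

Definition is_zero (M : grMod A) : Prop := forall x : M, x = 0.

(* 0 -> M -> E_0 -> E_1 -> ... -> E_n -> 0 *)
Definition injective_resolution_of_length (M : grMod A) (n : nat) : Prop :=
  exists (E : nat -> grMod A) (e : grHom M (E 0%N))
         (d : forall i, grHom (E i) (E i.+1)),
    [/\ forall i, gr_injective (E i),
        forall i, (n < i)%N -> is_zero (E i),
        injective e,
        exact_at e (d 0%N)
      & forall i, exact_at (d i) (d i.+1)].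

(* 0 -> P_n -> ... -> P_1 -> P_0 -> M -> 0 *)
Definition projective_resolution_of_length (M : grMod A) (n : nat) : Prop :=
  exists (P : nat -> grMod A) (e : grHom (P 0%N) M)
         (d : forall i, grHom (P i.+1) (P i)),
    [/\ forall i, gr_projective (P i),
        forall i, (n < i)%N -> is_zero (P i),
        forall y, exists x, e x = y,
        exact_at (d 0%N) e
      & forall i, exact_at (d i.+1) (d i)].

(* Dimensions take values in the extended naturals, None being infinity. *)
Definition least_or_infinity (P : nat -> Prop) : option nat :=
  match pselect (exists n, `[< P n >]) with
  | left exP => Some (ex_minn exP)
  | right _ => None
  end.

Definition injective_dimension (M : grMod A) : option nat :=
  least_or_infinity (injective_resolution_of_length M).

Definition projective_dimension (M : grMod A) : option nat :=
  least_or_infinity (projective_resolution_of_length M).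

End GradedAlgebras.

Definition dim_le (m n : option nat) : Prop :=
  match m, n with
  | _, None => True
  | None, Some _ => False
  | Some m, Some n => (m <= n)%N
  end.

Section ChangeOfGrading.
Variables (k : comPzRingType) (G G' : groupType) (phi : UMagmaMorphism.type G G').
Variable A : grAlg k G.

Lemma push_mul (R M : zmodType) (op : R -> M -> M)
    (R_ : G -> set R) (M_ : G -> set M) :
  (forall a, {morph op a : x y / x + y}) -> (forall a, op a 0 = 0) ->
  (forall x, {morph op^~ x : a b / a + b}) -> (forall x, op 0 x = 0) ->
  (forall g, subgroup_closed (R_ g)) -> (forall g, subgroup_closed (M_ g)) ->
  (forall g g' a x, R_ g a -> M_ g' x -> M_ (g * g')%g (op a x)) ->
  forall h h' a x, push_pieces phi R_ h a -> push_pieces phi M_ h' x ->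
    push_pieces phi M_ (h * h')%g (op a x).
Proof.
move=> opDr op0r opDl op0l Rs Ms RM h h' a x.
move=> [s [c [_ sh cR ->]]] [t [d [_ th dM ->]]].
rewrite (big_morph (op^~ _) (opDl _) (op0l _)).
apply: subgroup_sum => [|g gs]; first exact: internal_sum_sub.
rewrite (big_morph (op _) (opDr _) (op0r _)).
apply: subgroup_sum => [|g' gt]; first exact: internal_sum_sub.
apply: (internal_sum1 _ (i := (g * g')%g)) => //=; last exact: RM.
by rewrite gmulfM (sh _ gs) (th _ gt).
Qed.

Let A_ := @gralg_piece k G A.

Lemma push_alg_sum : internal_direct_sum (push_pieces phi A_).
Proof. by have [? _ _] := gralg_sum A; apply: push_direct_sum (gralg_sum _). Qed.

Lemma push_alg_scale h (c : k) x :
  push_pieces phi A_ h x -> push_pieces phi A_ h (kalg_map A c * x).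
Proof.
move=> [s [e [us sh eA ->]]]; exists s, (fun g => kalg_map A c * e g); split=> //.
  by move=> g; apply: gralg_scale; apply: eA.
by rewrite mulr_sumr.
Qed.

Lemma push_alg_mul h h' x y :
  push_pieces phi A_ h x -> push_pieces phi A_ h' y ->
  push_pieces phi A_ (h * h')%g (x * y).
Proof.
have [As _ _] := gralg_sum A.
apply: (@push_mul A A *%R) => //.
- by move=> a u v; rewrite mulrDr.
- by move=> a; rewrite mulr0.
- by move=> a u v; rewrite mulrDl.
- by move=> a; rewrite mul0r.
- by move=> g g' a u; apply: gralg_mul.
Qed.

Definition push_alg : grAlg k G' :=
  GrAlg push_alg_sum push_alg_scale push_alg_mul.

Variable M : grMod A.

Let M_ := @grmod_piece k G A M.

Lemma push_mod_sum : internal_direct_sum (push_pieces phi M_).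
Proof. by have [? _ _] := grmod_sum M; apply: push_direct_sum (grmod_sum _). Qed.

Lemma push_mod_scale h h' (a : A) (x : M) :
  push_pieces phi A_ h a -> push_pieces phi M_ h' x ->
  push_pieces phi M_ (h * h')%g (a *: x).
Proof.
have [As _ _] := gralg_sum A; have [Ms _ _] := grmod_sum M.
apply: (@push_mul A M *:%R) => //.
- by move=> b u v; rewrite scalerDr.
- by move=> b; rewrite scaler0.
- by move=> u b c; rewrite scalerDl.
- by move=> u; rewrite scale0r.
- by move=> g g' b u; apply: grmod_scale.
Qed.

(* The functor phi_! on objects. *)
Definition push_mod : grMod push_alg :=
  @GrMod k G' push_alg (M : lmodType A) _ push_mod_sum push_mod_scale.

End ChangeOfGrading.

(* The group algebra. The ring structure of monalg is not available: it        *)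
(* requires monoids without nontrivial units and a nonzero base ring.          *)

Definition group_algebra (k : comPzRingType) (G : groupType) : Type :=
  {malg k[G]}.

HB.instance Definition _ k G := GRing.Zmodule.copy (group_algebra k G) {malg k[G]}.

Section Convolution.
Variable k : comPzRingType.

(* The biadditive extension of (a u_g, b u_h) |-> (a b) u_(phi(g) h). *)
Definition convolution (G H : groupType) (phi : G -> H)
    (a : group_algebra k G) (b : group_algebra k H) : group_algebra k H :=
  \sum_(g <- msupp a) \sum_(h <- msupp b) << a@_g * b@_h *g (phi g * h)%g >>.

Section Theory.
Variables (G H : groupType) (phi : G -> H).
Local Notation conv := (convolution phi).
Implicit Types (a : group_algebra k G) (b : group_algebra k H).

Lemma convEw (d1 : {fset G}) (d2 : {fset H}) a b :
  (msupp a `<=` d1)%fset -> (msupp b `<=` d2)%fset ->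
  conv a b = \sum_(g <- d1) \sum_(h <- d2) << a@_g * b@_h *g (phi g * h)%g >>.
Proof.
move=> le1 le2; rewrite /convolution (big_fset_incl _ le1) /=.
  apply/eq_bigr => g _; apply/big_fset_incl => // h _ /mcoeff_outdom ->.
  by rewrite mulr0 monalgU0.
move=> g _ /mcoeff_outdom ag; rewrite big1 // => h _.
by rewrite ag mul0r monalgU0.
Qed.

Lemma convUU c g d h :
  conv << c *g g >> << d *g h >> = << c * d *g (phi g * h)%g >>.
Proof. by rewrite (convEw msuppU_le msuppU_le) !big_seq_fset1 !mcoeffUU. Qed.

Lemma convDl a a' b : conv (a + a') b = conv a b + conv a' b.
Proof.
rewrite (convEw (msuppD_le a a') (fsubset_refl _)).
rewrite (convEw (fsubsetUl _ (msupp a')) (fsubset_refl _)).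
rewrite (convEw (fsubsetUr (msupp a) _) (fsubset_refl _)).
rewrite -big_split /=; apply/eq_bigr => g _.
rewrite -big_split /=; apply/eq_bigr => h _.
by rewrite mcoeffD mulrDl monalgUD.
Qed.

Lemma convDr a b b' : conv a (b + b') = conv a b + conv a b'.
Proof.
rewrite (convEw (fsubset_refl _) (msuppD_le b b')).
rewrite (convEw (fsubset_refl _) (fsubsetUl _ (msupp b'))).
rewrite (convEw (fsubset_refl _) (fsubsetUr (msupp b) _)).
rewrite -big_split /=; apply/eq_bigr => g _.
rewrite -big_split /=; apply/eq_bigr => h _.
by rewrite mcoeffD mulrDr monalgUD.
Qed.

Lemma conv0l b : conv 0 b = 0.
Proof. by rewrite /convolution msupp0 big_seq_fset0. Qed.

Lemma conv0r a : conv a 0 = 0.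
Proof.
by rewrite /convolution big1 // => g _; rewrite msupp0 big_seq_fset0.
Qed.

Lemma conv_suml T (s : seq T) (F : T -> group_algebra k G) b :
  conv (\sum_(i <- s) F i) b = \sum_(i <- s) conv (F i) b.
Proof. exact: (big_morph (conv^~ b) (fun x y => convDl x y b) (conv0l b)). Qed.

Lemma conv_sumr T (s : seq T) (F : T -> group_algebra k H) a :
  conv a (\sum_(i <- s) F i) = \sum_(i <- s) conv a (F i).
Proof. exact: (big_morph (conv a) (convDr a) (conv0r a)). Qed.

Lemma convEl a b : conv a b = \sum_(g <- msupp a) conv << a@_g *g g >> b.
Proof. by rewrite -(conv_suml _ (fun g => << a@_g *g g >>)) -monalgE. Qed.

Lemma convEr a b : conv a b = \sum_(h <- msupp b) conv a << b@_h *g h >>.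
Proof. by rewrite -(conv_sumr _ (fun h => << b@_h *g h >>)) -monalgE. Qed.

End Theory.

Lemma conv1 (G H : groupType) (phi : UMagmaMorphism.type G H)
    (b : group_algebra k H) :
  convolution phi << 1 *g (1%g : G) >> b = b.
Proof.
rewrite convEr [RHS]monalgE; apply/eq_bigr => h _.
by rewrite convUU mul1r gmulf1 mul1g.
Qed.

Lemma convA (G H : groupType) (phi : UMagmaMorphism.type G H)
    (a b : group_algebra k G) (c : group_algebra k H) :
  convolution phi a (convolution phi b c)
    = convolution phi (convolution idfun a b) c.
Proof.
rewrite convEl (convEl idfun a b) conv_suml; apply/eq_bigr => g _.
rewrite (convEl phi b c) (convEr idfun _ b) conv_sumr conv_suml.
apply/eq_bigr => h _; rewrite (convEr phi _ c) conv_sumr (convEr phi _ c).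
by apply/eq_bigr => l _; rewrite !convUU mulrA gmulfM mulgA.
Qed.

End Convolution.

Section GroupAlgebra.
Variables (k : comPzRingType) (G : groupType).
Local Notation kG := (group_algebra k G).
Local Notation mul := (@convolution k G G idfun).

Lemma group_algebra_mulA : associative mul.
Proof. exact: (convA idfun). Qed.

Lemma group_algebra_mul1 : left_id (<< 1 *g (1%g : G) >> : kG) mul.
Proof. exact: (conv1 idfun). Qed.

Lemma group_algebra_mulr1 : right_id (<< 1 *g (1%g : G) >> : kG) mul.
Proof.
move=> a; rewrite convEl [RHS]monalgE; apply/eq_bigr => g _.
by rewrite convUU mulr1 mulg1.
Qed.

HB.instance Definition _ := GRing.Zmodule_isPzRing.Build kG
  group_algebra_mulA group_algebra_mul1 group_algebra_mulr1
  (@convDl k G G idfun) (@convDr k G G idfun).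

Definition group_algebra_map (c : k) : kG := << c *g (1%g : G) >>.

Lemma group_algebra_map_additive : zmod_morphism group_algebra_map.
Proof. exact: monalgUB. Qed.

Lemma group_algebra_map_multiplicative : monoid_morphism group_algebra_map.
Proof. by split=> // c d; rewrite [RHS]convUU mulg1. Qed.

HB.instance Definition _ :=
  GRing.isZmodMorphism.Build k kG group_algebra_map group_algebra_map_additive.
HB.instance Definition _ :=
  GRing.isMonoidMorphism.Build k kG group_algebra_map
    group_algebra_map_multiplicative.

Lemma group_algebra_central c (a : kG) :
  group_algebra_map c * a = a * group_algebra_map c.
Proof.
rewrite [LHS]convEr [RHS]convEl; apply/eq_bigr => g _.
by rewrite !convUU mul1g mulg1 mulrC.
Qed.

Definition group_kalg : kAlgebra k :=
  @KAlgebra k kG group_algebra_map group_algebra_central.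

Definition group_piece (g : G) : set kG := [set a | exists c, a = << c *g g >>].

Lemma group_sum : internal_direct_sum group_piece.
Proof.
split=> [g|a|s c us cU sc0 g gs].
- split=> [|_ _ [c ->] [d ->]]; first by exists 0; rewrite monalgU0.
  by exists (c - d); rewrite monalgUB.
- exists (msupp a), (fun g => << a@_g *g g >>); split=> //.
  + by move=> g; exists a@_g.
  + exact: monalgE.
have [d cd] := choice cU.
rewrite cd; move/(congr1 (mcoeff g)): sc0.
rewrite raddf_sum mcoeff0 (bigD1_seq g) //= cd mcoeffUU big1 ?addr0 => [->|h hg].
  by rewrite monalgU0.
by rewrite cd mcoeffU (negbTE hg).
Qed.

Lemma group_scale g (c : k) x :
  group_piece g x -> group_piece g (group_algebra_map c * x).
Proof. by move=> [d ->]; exists (c * d); rewrite [LHS]convUU mul1g. Qed.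

Lemma group_mul g g' x y :
  group_piece g x -> group_piece g' y -> group_piece (g * g')%g (x * y).
Proof. by move=> [c ->] [d ->]; exists (c * d); rewrite [LHS]convUU. Qed.

Definition group_gralg : grAlg k G :=
  @GrAlg k G group_kalg group_piece group_sum group_scale group_mul.

End GroupAlgebra.

Section TargetGroupModule.
Variables (k : comPzRingType) (G G' : groupType) (phi : UMagmaMorphism.type G G').

(* kG' with the left kG-action u_g . u_h = u_(phi(g) h) *)
Definition target_group_module : Type :=
  let _ := phi in group_algebra k G'.

Local Notation kG := (group_algebra k G).
Local Notation kG' := target_group_module.

HB.instance Definition _ := GRing.Zmodule.copy kG' (group_algebra k G').

Definition target_group_scale (a : kG) (x : kG') : kG' := convolution phi a x.

Lemma target_group_scaleA a b x :
  target_group_scale a (target_group_scale b x) = target_group_scale (a * b) x.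
Proof. exact: convA. Qed.

Lemma target_group_scale1 : left_id 1 target_group_scale.
Proof. exact: conv1. Qed.

Lemma target_group_scaleDr : right_distributive target_group_scale +%R.
Proof. by move=> a x y; apply: convDr. Qed.

Lemma target_group_scaleDl x : {morph target_group_scale^~ x : a b / a + b}.
Proof. by move=> a b; apply: convDl. Qed.

HB.instance Definition _ := GRing.Zmodule_isLmodule.Build kG kG'
  target_group_scaleA target_group_scale1
  target_group_scaleDr target_group_scaleDl.

Lemma target_group_scaleU (c d : k) (g : G) (h : G') :
  (<< c *g g >> : kG) *: (<< d *g h >> : kG') = << c * d *g (phi g * h)%g >>.
Proof. exact: convUU. Qed.

Definition target_group_piece (h : G') : set kG' := group_piece h.

Lemma target_group_sum : internal_direct_sum target_group_piece.
Proof. exact: group_sum. Qed.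

Lemma target_group_grscale h h' (a : push_alg phi (group_gralg k G)) (x : kG') :
  gralg_piece h a -> target_group_piece h' x ->
  target_group_piece (h * h')%g ((a : kG) *: x).
Proof.
move=> [s [c [_ sh cU ->]]] [d ->]; rewrite scaler_suml.
have [subs _ _] := target_group_sum.
apply: subgroup_sum => // g gs.
have [e ->] := cU g; exists (e * d).
by rewrite target_group_scaleU (sh _ gs).
Qed.

Definition target_group_grmod : grMod (push_alg phi (group_gralg k G)) :=
  @GrMod k G' (push_alg phi (group_gralg k G))
    (kG' : lmodType kG) _ target_group_sum target_group_grscale.

End TargetGroupModule.

(* Main.v *)
Require Import Defs.
From HB Require Import structures.
From mathcomp Require Import all_boot all_algebra finmap.
From mathcomp Require Import boolp classical_sets functions monalg.

Set Implicit Arguments.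
Unset Strict Implicit.
Unset Printing Implicit Defensive.

Import GRing.Theory.
Local Open Scope ring_scope.
Local Open Scope classical_set_scope.

(** A projective resolution of kG' over kG is turned, term by term, into an
    injective resolution of the regraded module X = phi_!(I).

    For a G'-graded kG-module P and a G'-graded A-module X, let Hom(P, X) be
    the graded A-module whose part of degree h is Hom_k(P_h, X_h), on which a
    homogeneous a of degree g in G acts by (a y)(p) = a y(g^-1 p); this is
    [internal_hom].  It is contravariant in P, and Hom(kG', X) = X because
    (kG')_h = k ([unit_hom]).  If P_0, P_1, ... is a projective resolution of
    kG', then
        0 -> X = Hom(kG', X) -> Hom(P_0, X) -> Hom(P_1, X) -> ...
    is exact and consists of injective modules, and Hom(P_i, X) vanishes as
    soon as P_i does.

    Exactness: kG' is free over k in each degree and each P_i is k-projective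
    in each degree, hence the resolution has a contracting homotopy made of
    degree-preserving k-linear maps ([splitting_base], [splitting_step]), which
    is all that Hom_k(-, X) requires ([hom_map_exact]).

    Injectivity ([internal_hom_injective]): by currying, a morphism from M to
    Hom(P, X) is a morphism of graded kG-modules from P to Q(M, X), where
    Q(M, X)_t is the set of A-linear maps, homogeneous for the G-grading, from
    phi^*(M)(t) to phi^*(X)(t); here phi^*(M)(t) has part M_(phi(g) t) in degree
    g.  As P is projective, it suffices that Q(N, X) -> Q(M, X) be surjective
    for every inclusion of M into N, that is, that phi^*(X)(t) be injective.
    But phi^*(phi_!(I))(t) is the direct sum of the shifts I(s) over the s with
    phi(s) = t, and a direct sum of injective graded modules over a noetherian
    graded algebra is injective by Baer's criterion: the values of a morphism
    on a graded left ideal involve only finitely many of the summands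
    ([regraded_bounded], [regraded_extend], [regraded_family_extension]). *)

(** * Additive maps and homogeneous components *)

Section ZmodMorphism.
Variables (U V : zmodType) (f : U -> V).
Hypothesis fB : zmod_morphism f.

Lemma zmod_morphism0 : f 0 = 0.
Proof. by rewrite -(subrr 0) fB subrr. Qed.

Lemma zmod_morphismN x : f (- x) = - f x.
Proof. by rewrite -(sub0r x) fB zmod_morphism0 sub0r. Qed.

Lemma zmod_morphismD x y : f (x + y) = f x + f y.
Proof. by rewrite -{1}(opprK y) fB zmod_morphismN opprK. Qed.

Lemma zmod_morphism_sum T (s : seq T) (F : T -> U) :
  f (\sum_(i <- s) F i) = \sum_(i <- s) f (F i).
Proof. exact: (big_morph f zmod_morphismD zmod_morphism0). Qed.

End ZmodMorphism.

Lemma morphD_zmod_morphism (U V : zmodType) (f : U -> V) :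
  {morph f : x y / x + y} -> zmod_morphism f.
Proof. by move=> fD x y; apply/eqP; rewrite -subr_eq opprK -fD subrK. Qed.

Section SubgroupClosed.
Variables (V : zmodType) (S : set V).
Hypothesis Ssub : subgroup_closed S.

Lemma subgroup0 : S 0. Proof. by case: Ssub. Qed.

Lemma subgroupB x y : S x -> S y -> S (x - y).
Proof. by case: Ssub => _; apply. Qed.

Lemma subgroupN x : S x -> S (- x).
Proof. by rewrite -sub0r; apply: subgroupB; apply: subgroup0. Qed.

Lemma subgroupD x y : S x -> S y -> S (x + y).
Proof. by move=> Sx Sy; rewrite -(opprK y); apply/subgroupB/subgroupN. Qed.

End SubgroupClosed.

Definition independent (I : choiceType) (V : zmodType) (V_ : I -> set V) :=
  forall (s : seq I) (c : I -> V), uniq s -> (forall i, V_ i (c i)) ->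
    \sum_(i <- s) c i = 0 -> forall i, i \in s -> c i = 0.

Section Components.
Variables (I : choiceType) (V : zmodType) (V_ : I -> set V).
Hypothesis dsV : internal_direct_sum V_.

Lemma piece_sub i : subgroup_closed (V_ i).
Proof. by case: dsV. Qed.

(** Homogeneous elements generate, so a subgroup containing them is
    everything; nearly all identities below are checked on homogeneous
    elements only. *)
Lemma homogeneous_ind (P : set V) :
  subgroup_closed P -> (forall i x, V_ i x -> P x) -> forall x, P x.
Proof.
move=> Psub PV x; case: dsV => _ /(_ x)[s [c [_ _ cV ->]]] _.
by apply: subgroup_sum => // i _; apply: PV (cV i).
Qed.

Lemma homogeneous_ext (U : zmodType) (f g : V -> U) :
  zmod_morphism f -> zmod_morphism g ->
  (forall i x, V_ i x -> f x = g x) -> f =1 g.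
Proof.
move=> fB gB fg x; apply: (homogeneous_ind (P := [set x | f x = g x])) => //=.
split=> [|y z /= fy fz]; first by rewrite /= !zmod_morphism0.
by rewrite fB gB fy fz.
Qed.

(** The component is obtained by choice, so that it is a function of the family
    of pieces alone and not of the proof that their sum is direct. *)
Definition component (i : I) (x : V) : V :=
  xget 0 [set y | exists s c, [/\ uniq s, forall j, V_ j (c j),
    x = \sum_(j <- s) c j & y = if i \in s then c i else 0]].

Lemma decomposition_unique (s t : seq I) (c d : I -> V) :
  uniq s -> uniq t -> (forall i, V_ i (c i)) -> (forall i, V_ i (d i)) ->
  \sum_(i <- s) c i = \sum_(i <- t) d i ->
  forall i, (if i \in s then c i else 0) = (if i \in t then d i else 0).
Proof.
move=> us ut cV dV cd i; set u := undup (s ++ t).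
have uu : uniq u by rewrite undup_uniq.
case iu: (i \in u); last first.
  by move: iu; rewrite mem_undup mem_cat => /norP[/negbTE-> /negbTE->].
apply/eqP; rewrite -subr_eq0; apply/eqP.
case: dsV => _ _ /(_ u (fun i => (if i \in s then c i else 0)
  - (if i \in t then d i else 0)) uu); apply=> // [j|].
  apply: (subgroupB (piece_sub j)); case: ifP => // _;
    exact: (subgroup0 (piece_sub j)).
rewrite sumrB -!big_uniq_widen // ?cd ?subrr // => j jt;
  by rewrite mem_undup mem_cat jt ?orbT.
Qed.

Lemma componentE (s : seq I) (c : I -> V) i :
  uniq s -> (forall i, V_ i (c i)) ->
  component i (\sum_(j <- s) c j) = if i \in s then c i else 0.
Proof.
move=> us cV; rewrite /component; case: xgetP => [y -> [t [d [ut dV cd ->]]]|].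
  by apply/esym/decomposition_unique.
by move=> /(_ (if i \in s then c i else 0)) []; exists s, c.
Qed.

Lemma component_piece i x : V_ i (component i x).
Proof.
case: dsV => _ /(_ x)[s [c [us _ cV ->]]] _; rewrite componentE //.
by case: ifP => // _; exact: (subgroup0 (piece_sub _)).
Qed.

Lemma component_id i x : V_ i x -> component i x = x.
Proof.
move=> Vx; pose c j := if j == i then x else 0.
have -> : x = \sum_(j <- [:: i]) c j by rewrite big_seq1 /c eqxx.
rewrite componentE // ?inE ?eqxx ?big_seq1 // => j.
by rewrite /c; case: eqP => [->//|_]; exact: (subgroup0 (piece_sub _)).
Qed.

Lemma component_neq i j x : V_ j x -> i != j -> component i x = 0.
Proof.
move=> Vx /negbTE ij; pose c l := if l == j then x else 0.
have -> : x = \sum_(l <- [:: j]) c l by rewrite big_seq1 /c eqxx.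
rewrite componentE // ?inE ?ij // => l.
by rewrite /c; case: eqP => [->//|_]; exact: (subgroup0 (piece_sub _)).
Qed.

Lemma component_support x : exists2 s, uniq s &
  (forall i, i \notin s -> component i x = 0)
  /\ x = \sum_(i <- s) component i x.
Proof.
case: dsV => _ /(_ x)[s [c [us _ cV xE]]] _; exists s => //; split=> [i|].
  by rewrite xE componentE // => /negbTE ->.
rewrite [LHS]xE big_seq [RHS]big_seq; apply: eq_bigr => i si.
by rewrite xE componentE // si.
Qed.

Definition support_of x : seq I := s2val (cid2 (component_support x)).

Lemma support_of_uniq x : uniq (support_of x).
Proof. by rewrite /support_of; case: cid2. Qed.

Lemma support_ofP i x : i \notin support_of x -> component i x = 0.
Proof. by rewrite /support_of; case: cid2 => /= s us [+ _]; apply. Qed.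

Lemma component_sum x : x = \sum_(i <- support_of x) component i x.
Proof. by rewrite /support_of; case: cid2 => /= s us []. Qed.

Lemma component_inj x y : (forall i, component i x = component i y) -> x = y.
Proof.
move=> xy; rewrite (component_sum x) (component_sum y).
set s := support_of x; set t := support_of y; pose u := undup (s ++ t).
have uu : uniq u by rewrite undup_uniq.
rewrite (@big_uniq_widen _ _ s u) ?support_of_uniq //; last first.
  by move=> i si; rewrite mem_undup mem_cat si.
rewrite (@big_uniq_widen _ _ t u) ?support_of_uniq //; last first.
  by move=> i si; rewrite mem_undup mem_cat si orbT.
apply: eq_bigr => i _; case: ifP => [|/negbT/support_ofP /=]; case: ifP => //.
- by move=> /negbT/support_ofP <-.
- by rewrite xy.
Qed.

Lemma componentB i : zmod_morphism (component i).
Proof.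
move=> x y; set s := support_of x; set t := support_of y.
pose u := undup (s ++ t).
have uu : uniq u by rewrite undup_uniq.
have widen z r : r = support_of z -> {subset r <= u} ->
  z = \sum_(j <- u) component j z.
  move=> -> ru; rewrite {1}(component_sum z) (@big_uniq_widen _ _ _ u) //.
    by apply: eq_bigr => j _; case: ifP => // /negbT/support_ofP.
  exact: support_of_uniq.
have xE : x = \sum_(j <- u) component j x.
  by apply: (widen x s erefl) => j sj; rewrite mem_undup mem_cat sj.
have yE : y = \sum_(j <- u) component j y.
  by apply: (widen y t erefl) => j sj; rewrite mem_undup mem_cat sj orbT.
have -> : component i (x - y)
    = component i (\sum_(j <- u) component j x - \sum_(j <- u) component j y).
  by rewrite -xE -yE.
rewrite -sumrB componentE // => [|j].
  case: ifP => // /negbT; rewrite mem_undup mem_cat => /norP[is_ it].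
  by rewrite !support_ofP // subrr.
by apply: (subgroupB (piece_sub j)); apply: component_piece.
Qed.

Section Extend.
Variables (U : zmodType) (b : I -> V -> U).
Hypothesis bB : forall i, zmod_morphism (b i).

(** The universal property of the direct sum: only the values of b i on the
    piece of index i matter. *)
Definition extend x : U := \sum_(i <- support_of x) b i (component i x).

Lemma extend_widen x u : uniq u -> {subset support_of x <= u} ->
  extend x = \sum_(i <- u) b i (component i x).
Proof.
move=> uu su; rewrite /extend (@big_uniq_widen _ _ _ u) ?support_of_uniq //.
apply: eq_bigr => i _; case: ifP => // /negbT/support_ofP ->.
by rewrite zmod_morphism0.
Qed.

Lemma extendB : zmod_morphism extend.
Proof.
move=> x y; pose u := undup (support_of x ++ support_of y ++ support_of (x - y)).
rewrite !(@extend_widen _ u) ?undup_uniq //.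
- by rewrite -sumrB; apply: eq_bigr => i _; rewrite componentB bB.
- by move=> i xi; rewrite mem_undup !mem_cat xi orbT.
- by move=> i xi; rewrite mem_undup !mem_cat xi.
- by move=> i xi; rewrite mem_undup !mem_cat xi !orbT.
Qed.

Lemma extend_piece i x : V_ i x -> extend x = b i x.
Proof.
move=> Vx; rewrite (@extend_widen _ (undup (i :: support_of x))) ?undup_uniq //.
  rewrite (bigD1_seq i) ?mem_undup ?mem_head ?undup_uniq //.
  rewrite /= component_id // big1 ?addr0 // => j ji.
  by rewrite (component_neq Vx ji) zmod_morphism0.
by move=> j xj; rewrite mem_undup inE xj orbT.
Qed.

End Extend.

End Components.

(** * Graded algebras and modules *)

Section GradedFacts.
Variables (k : comPzRingType) (G : groupType) (A : grAlg k G).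

Lemma gralg_sub g : subgroup_closed (@gralg_piece k G A g).
Proof. exact: piece_sub (gralg_sum A) g. Qed.

Lemma grmod_sub (M : grMod A) g : subgroup_closed (@grmod_piece k G A M g).
Proof. exact: piece_sub (grmod_sum M) g. Qed.

(** The degree 1 component e of 1 is a right identity: in degree g, the
    decomposition of a = a * 1 reads a = a * e when a is homogeneous of degree
    g.  Hence e = 1 * e = 1. *)
Lemma gralg_piece1 : gralg_piece 1%g (1 : A).
Proof.
set e := component (@gralg_piece k G A) 1%g 1.
suff <- : e = 1 by apply: component_piece (gralg_sum A) _ _.
rewrite -[LHS]mul1r -[RHS](mulr1 1).
apply: (homogeneous_ext (gralg_sum A) (f := fun a => a * e)
  (g := fun a => a * 1)) => [a b|a b|g a Aa]; rewrite ?mulrBl //.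
rewrite mulr1 -[RHS](component_id (gralg_sum A) Aa).
have -> : component (@gralg_piece k G A) g a = \sum_(h <- support_of (gralg_sum A) 1)
    component (@gralg_piece k G A) g (a * component (@gralg_piece k G A) h 1).
  rewrite -(zmod_morphism_sum (componentB (gralg_sum A) g)) -mulr_sumr.
  by rewrite -component_sum mulr1.
set s := support_of _ _.
have term h : component (@gralg_piece k G A) g
    (a * component (@gralg_piece k G A) h 1) = if h == 1%g then a * e else 0.
  have Ah : gralg_piece (g * h)%g (a * component (@gralg_piece k G A) h 1).
    apply: (gralg_mul Aa); apply: component_piece (gralg_sum A) _ _.
  case: eqP => [h1|/eqP h1]; last first.
    apply: (component_neq (gralg_sum A) Ah).
    by rewrite eq_sym -[X in _ != X]mulg1 (inj_eq (mulgI g)).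
  by rewrite h1 mulg1 in Ah *; rewrite (component_id (gralg_sum A)).
under eq_bigr => h _ do rewrite term.
rewrite -big_mkcond /=; case s1: (1%g \in s).
  by rewrite -big_filter filter_pred1_uniq ?big_seq1 ?support_of_uniq.
rewrite big_seq_cond big1 => [|h /andP[hs /eqP h1]]; last by rewrite -h1 hs in s1.
by rewrite /e (support_ofP (dsV := gralg_sum A)) ?mulr0 // -/s s1.
Qed.

Lemma gralg_piece_map c : gralg_piece 1%g (kalg_map A c).
Proof. by rewrite -[kalg_map A c]mulr1; apply/gralg_scale/gralg_piece1. Qed.

Lemma grmod_piece_map (M : grMod A) g c (x : M) :
  grmod_piece g x -> grmod_piece g (kalg_map A c *: x).
Proof. by move=> Mx; rewrite -[g]mul1g; apply: grmod_scale (gralg_piece_map c) Mx. Qed.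

Lemma component_mul g h (a b : A) : gralg_piece g a ->
  component (@gralg_piece k G A) (g * h)%g (a * b)
    = a * component (@gralg_piece k G A) h b.
Proof.
move=> Aa; move: b.
apply: (homogeneous_ext (gralg_sum A)
  (f := fun b => component (@gralg_piece k G A) (g * h)%g (a * b))
  (g := fun b => a * component (@gralg_piece k G A) h b)) => [b c|b c|l b Ab].
- by rewrite mulrBr (componentB (gralg_sum A)).
- by rewrite (componentB (gralg_sum A)) mulrBr.
have [<-|hl] := eqVneq l h.
  by rewrite !(component_id (gralg_sum A)) //; apply: gralg_mul.
rewrite (component_neq (gralg_sum A) (gralg_mul Aa Ab)); last first.
  by rewrite (inj_eq (mulgI g)) eq_sym.
by rewrite (component_neq (gralg_sum A) Ab) ?mulr0 // eq_sym.
Qed.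

Lemma component_scale (M : grMod A) g h (a : A) (x : M) : gralg_piece g a ->
  component (@grmod_piece k G A M) (g * h)%g (a *: x)
    = a *: component (@grmod_piece k G A M) h x.
Proof.
move=> Aa; move: x.
apply: (homogeneous_ext (grmod_sum M)
  (f := fun b => component (@grmod_piece k G A M) (g * h)%g (a *: b))
  (g := fun b => a *: component (@grmod_piece k G A M) h b)) => [b c|b c|l b Ab].
- by rewrite scalerBr (componentB (grmod_sum M)).
- by rewrite (componentB (grmod_sum M)) scalerBr.
have [<-|hl] := eqVneq l h.
  by rewrite !(component_id (grmod_sum M)) //; apply: grmod_scale.
rewrite (component_neq (grmod_sum M) (grmod_scale Aa Ab)); last first.
  by rewrite (inj_eq (mulgI g)) eq_sym.
by rewrite (component_neq (grmod_sum M) Ab) ?scaler0 // eq_sym.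
Qed.

Lemma grhomB (M N : grMod A) (f : grHom M N) : zmod_morphism f.
Proof. exact: raddfB. Qed.

Lemma component_hom (M N : grMod A) (f : grHom M N) g x :
  component (@grmod_piece k G A N) g (f x)
    = f (component (@grmod_piece k G A M) g x).
Proof.
move: x; apply: (homogeneous_ext (grmod_sum M)
  (f := fun b => component (@grmod_piece k G A N) g (f b))
  (g := fun b => f (component (@grmod_piece k G A M) g b))) => [b c|b c|l b Mb].
- by rewrite raddfB (componentB (grmod_sum N)).
- by rewrite (componentB (grmod_sum M)) raddfB.
have [<-|hl] := eqVneq l g.
  by rewrite !component_id //;
    [exact: grmod_sum|exact: grmod_sum|exact: grhom_piece].
by rewrite (component_neq (grmod_sum N) (grhom_piece _ Mb)) 1?eq_sym //
  (component_neq (grmod_sum M) Mb) 1?eq_sym // raddf0.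
Qed.

(** Graded modules are obtained below as spans of independent families of
    subgroups of some large additive group, mostly a group of functions.  The
    operation need be additive in the scalar on the family only: translation
    of functions on a ring is additive in the scalar on additive functions. *)
Record gradedFamily : Type := GradedFamily {
  fam_sort : zmodType;
  fam_op : A -> fam_sort -> fam_sort;
  fam_piece : G -> set fam_sort;
  fam_sub : forall g, subgroup_closed (fam_piece g);
  fam_independent : independent fam_piece;
  fam_opB : forall a, zmod_morphism (fam_op a);
  fam_opA : forall a b w, fam_op a (fam_op b w) = fam_op (a * b) w;
  fam_op1 : forall w, fam_op 1 w = w;
  fam_opDl : forall g w, fam_piece g w -> {morph fam_op^~ w : a b / a + b};
  fam_op_piece : forall g g' a w,
    gralg_piece g a -> fam_piece g' w -> fam_piece (g * g')%g (fam_op a w)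
}.

Section Span.
Variable F : gradedFamily.
Local Notation W := (fam_sort F).
Local Notation span_set := (internal_sum (@fam_piece F) setT).

Definition span_type : Type := {w : W | `[< span_set w >]}.

Definition span_val (w : span_type) : W := sval w.

HB.instance Definition _ := Choice.on span_type.

Lemma span_valP (w : span_type) : span_set (span_val w).
Proof. exact/asboolP/(svalP w). Qed.

Definition span_elt w (Sw : span_set w) : span_type := exist _ w (asboolT Sw).

Lemma span_val_inj : injective span_val.
Proof. exact: val_inj. Qed.

Lemma span_set_sub : subgroup_closed span_set.
Proof. exact/internal_sum_sub/fam_sub. Qed.

Definition span_add u v :=
  span_elt (subgroupD span_set_sub (span_valP u) (span_valP v)).
Definition span_zero := span_elt (subgroup0 span_set_sub).
Definition span_opp u := span_elt (subgroupN span_set_sub (span_valP u)).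

Lemma span_addA : associative span_add.
Proof. by move=> u v w; apply: span_val_inj; apply: addrA. Qed.
Lemma span_addC : commutative span_add.
Proof. by move=> u v; apply: span_val_inj; apply: addrC. Qed.
Lemma span_add0 : left_id span_zero span_add.
Proof. by move=> u; apply: span_val_inj; apply: add0r. Qed.
Lemma span_addN : left_inverse span_zero span_opp span_add.
Proof. by move=> u; apply: span_val_inj; apply: addNr. Qed.

HB.instance Definition _ := GRing.isZmodule.Build span_type
  span_addA span_addC span_add0 span_addN.

Lemma span_ind (P : set W) : subgroup_closed P ->
  (forall g w, fam_piece g w -> P w) -> forall w, span_set w -> P w.
Proof.
move=> Psub PW w [s [c [_ _ cW ->]]].
by apply: subgroup_sum => // g _; apply: PW (cW g).
Qed.

Lemma span_op a w : span_set w -> span_set (fam_op a w).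
Proof.
move=> Sw; move: a; apply: (homogeneous_ind (gralg_sum A)).
  split=> [|a b Sa Sb].
    suff -> : fam_op 0 w = 0 by exact: (subgroup0 span_set_sub).
    move: w Sw; apply: span_ind => [|g w Ww].
      split=> [|v v' /= v0 v0']; first exact: (zmod_morphism0 (@fam_opB F _)).
      by rewrite /= fam_opB v0 v0' subrr.
    exact: (zmod_morphism0 (morphD_zmod_morphism (fam_opDl Ww))).
  suff -> : fam_op (a - b) w = fam_op a w - fam_op b w.
    exact: (subgroupB span_set_sub Sa Sb).
  move: w Sw {Sa Sb}; apply: span_ind => [|g w Ww].
    split=> [|v v' /= vE vE'].
      by rewrite /= !(zmod_morphism0 (@fam_opB F _)) subrr.
    by rewrite /= !fam_opB vE vE' !opprD !opprK addrACA.
  exact: (morphD_zmod_morphism (fam_opDl Ww)).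
move=> g a Aa; move: w Sw; apply: span_ind => [|g' w Ww].
  split=> [|v v' Sv Sv'] /=.
    by rewrite (zmod_morphism0 (@fam_opB F _)); exact: (subgroup0 span_set_sub).
  by rewrite fam_opB; exact: (subgroupB span_set_sub Sv Sv').
exact: (internal_sum1 (@fam_sub F) (i := (g * g')%g)) (fam_op_piece Aa Ww).
Qed.

Definition span_scale (a : A) (w : span_type) : span_type :=
  span_elt (span_op a (span_valP w)).

Lemma span_scaleA a b w : span_scale a (span_scale b w) = span_scale (a * b) w.
Proof. exact/span_val_inj/fam_opA. Qed.
Lemma span_scale1 : left_id 1 span_scale.
Proof. by move=> w; apply/span_val_inj/fam_op1. Qed.
Lemma span_scaleDr : right_distributive span_scale +%R.
Proof.
by move=> a u v; apply: span_val_inj; apply: (zmod_morphismD (@fam_opB F a)).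
Qed.
Lemma span_scaleDl w : {morph span_scale^~ w : a b / a + b}.
Proof.
move=> a b; apply: span_val_inj; move: (span_valP w) => /=.
move: (span_val w); apply: span_ind => [|g v Wv] /=; last exact: fam_opDl Wv _ _.
split=> [|v v' /= vE vE'].
  by rewrite /= !(zmod_morphism0 (@fam_opB F _)) addr0.
by rewrite /= !fam_opB vE vE' opprD addrACA.
Qed.

HB.instance Definition _ := GRing.Zmodule_isLmodule.Build A span_type
  span_scaleA span_scale1 span_scaleDr span_scaleDl.

Definition span_piece g : set span_type := [set w | fam_piece g (span_val w)].

Lemma span_val_sum T (s : seq T) (c : T -> span_type) :
  span_val (\sum_(i <- s) c i) = \sum_(i <- s) span_val (c i).
Proof. exact: (big_morph span_val). Qed.

Lemma span_sum : internal_direct_sum span_piece.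
Proof.
split=> [g|w|s c us cW sc0 g gs].
- split=> [|u v Wu Wv]; first exact: (subgroup0 (@fam_sub F g)).
  exact: (subgroupB (@fam_sub F g) Wu Wv).
- have [s [c [us _ cW wE]]] := span_valP w.
  have Sc g : span_set (c g) by apply: (internal_sum1 (@fam_sub F)) (cW g).
  exists s, (fun g => span_elt (Sc g)); split=> //.
  by apply: span_val_inj; rewrite span_val_sum.
apply: span_val_inj; apply: (fam_independent us (c := span_val \o c)) => //=.
by rewrite -span_val_sum sc0.
Qed.

Lemma span_grscale g g' (a : A) (w : span_type) :
  gralg_piece g a -> span_piece g' w -> span_piece (g * g')%g (a *: w).
Proof. exact: fam_op_piece. Qed.

Definition span_mod : grMod A :=
  @GrMod k G A (span_type : lmodType A) _ span_sum span_grscale.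

End Span.

Section SpanHom.
Variables (M : grMod A) (F : gradedFamily) (f : M -> fam_sort F).
Hypothesis fB : zmod_morphism f.
Hypothesis fZ : forall a x, f (a *: x) = fam_op a (f x).
Hypothesis f_piece : forall g x, grmod_piece g x -> fam_piece g (f x).

Lemma span_hom_set x : internal_sum (@fam_piece F) setT (f x).
Proof.
move: x; apply: (homogeneous_ind (grmod_sum M)) => [|g x Mx].
  split=> [|x y Sx Sy].
    by rewrite /= (zmod_morphism0 fB); exact: (subgroup0 (span_set_sub F)).
  by rewrite /= fB; exact: (subgroupB (span_set_sub F) Sx Sy).
by apply: (internal_sum1 (@fam_sub F)) (f_piece Mx).
Qed.

Definition span_hom_fun x : span_mod F := span_elt (span_hom_set x).

Lemma span_hom_linear : linear span_hom_fun.
Proof.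
move=> a x y; apply: span_val_inj => /=.
by rewrite (zmod_morphismD fB) fZ.
Qed.

HB.instance Definition _ :=
  GRing.isLinear.Build A M (span_mod F) _ span_hom_fun span_hom_linear.

Definition span_hom : grHom M (span_mod F) :=
  @GrHom k G A M (span_mod F) span_hom_fun f_piece.

End SpanHom.

Section SpanMap.
Variables (F : gradedFamily) (N : grMod A) (f : fam_sort F -> N).
Hypothesis fB : zmod_morphism f.
Hypothesis fZ : forall g w a, fam_piece g w -> f (fam_op a w) = a *: f w.
Hypothesis f_piece : forall g w, fam_piece g w -> grmod_piece g (f w).

Definition span_map_fun (w : span_mod F) : N := f (span_val w).

Lemma span_map_linear : linear span_map_fun.
Proof.
move=> a u v; rewrite /span_map_fun [span_val _]/= (zmod_morphismD fB).
congr (_ + _); move: (span_val u) (span_valP u).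
apply: span_ind => [|g w Ww]; last exact: fZ Ww.
split=> [|w w' /= wE wE'].
  by rewrite /= (zmod_morphism0 (@fam_opB F _)) zmod_morphism0 // scaler0.
by rewrite /= (@fam_opB F a) !fB wE wE' scalerBr.
Qed.

HB.instance Definition _ :=
  GRing.isLinear.Build A (span_mod F) N _ span_map_fun span_map_linear.

Definition span_map : grHom (span_mod F) N :=
  @GrHom k G A (span_mod F) N span_map_fun (fun g w => @f_piece g (span_val w)).

End SpanMap.

End GradedFacts.

(** * Injectivity and chain conditions *)

(** Baer's criterion for a morphism from a graded left ideal to I that is given by
    its graph Gamma; the graph is itself a graded module and stands for the
    ideal. *)
Section Baer.
Variables (k : comPzRingType) (G : groupType) (A : grAlg k G) (I : grMod A).
Hypothesis injI : gr_injective I.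
Variables (s : G) (Gamma : G -> set (A^o * I)).
Hypothesis Gamma_sub : forall g, subgroup_closed (Gamma g).
Hypothesis Gamma_piece : forall g w, Gamma g w ->
  gralg_piece g w.1 /\ grmod_piece (g * s)%g w.2.
Hypothesis Gamma_scale : forall g h (b : A) w,
  gralg_piece g b -> Gamma h w -> Gamma (g * h)%g (b *: w).
Hypothesis Gamma_fun : forall g y, Gamma g (0, y) -> y = 0.

Lemma gamma_independent : independent (fun g => Gamma (g * s^-1)%g).
Proof.
move=> t c ut cG c0 g gt.
have [_ _ indA] := gralg_sum A.
have c1 : (c g).1 = 0.
  rewrite -(mulgVK s g).
  apply: (indA (map (fun g => g * s^-1)%g t) (fun g => (c (g * s)%g).1)).
  - by rewrite map_inj_uniq //; apply: mulIg.
  - by move=> h; have [] := Gamma_piece (cG (h * s)%g); rewrite mulgK.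
  - rewrite big_map; under eq_bigr => h _ do rewrite mulgVK.
    have fstB : zmod_morphism (@fst A^o I) by [].
    by rewrite -(zmod_morphism_sum fstB) c0.
  - by apply/mapP; exists g.
move: (cG g); rewrite [c g]surjective_pairing c1 => /Gamma_fun ->.
by [].
Qed.

(** The pair (a, y) receives the degree of y, so a of degree g has degree g s. *)
Definition graph_family : gradedFamily A.
Proof.
apply: (@GradedFamily k G A (A^o * I)%type (fun b w => b *: w)
  (fun g => Gamma (g * s^-1)%g)).
- by move=> g; apply: Gamma_sub.
- exact: gamma_independent.
- by move=> a x y; rewrite scalerBr.
- by move=> a b w; rewrite scalerA.
- by move=> w; rewrite scale1r.
- by move=> g w _ a b; rewrite scalerDl.
- by move=> g g' a w Aa Gw; rewrite -mulgA; apply: Gamma_scale.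
Defined.

Lemma shift_independent :
  independent (fun g => @gralg_piece k G A (g * s^-1)%g).
Proof.
move=> t c ut cA c0 g gt; have [_ _ indA] := gralg_sum A.
rewrite -(mulgVK s g).
apply: (indA (map (fun g => g * s^-1)%g t) (fun g => c (g * s)%g)).
- by rewrite map_inj_uniq //; apply: mulIg.
- by move=> h; have := cA (h * s)%g; rewrite mulgK.
- by rewrite big_map; under eq_bigr => h _ do rewrite mulgVK.
- by apply/mapP; exists g.
Qed.

(** The regular module with its grading shifted so that 1 has degree s. *)
Definition shift_family : gradedFamily A.
Proof.
apply: (@GradedFamily k G A A (fun b w => b * w)
  (fun g => @gralg_piece k G A (g * s^-1)%g)).
- by move=> g; apply: gralg_sub.
- exact: shift_independent.
- by move=> a x y; rewrite mulrBr.
- by move=> a b w; rewrite mulrA.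
- by move=> w; rewrite mul1r.
- by move=> g w _ a b; rewrite mulrDl.
- by move=> g g' a w Aa Aw; rewrite -mulgA; apply: gralg_mul.
Defined.

(** The graph spans a graded module that projects injectively to the shifted
    regular module and also projects to I; x is the image of 1 under an
    extension of the latter projection along the former. *)
Lemma graph_extend : exists2 x : I, grmod_piece s x &
  forall g (a : A) y, Gamma g (a, y) -> y = a *: x.
Proof.
pose f0 (w : span_mod graph_family) : A := (span_val w).1.
have f0B : zmod_morphism f0 by [].
have f0Z a w : f0 (a *: w) = @fam_op _ _ _ shift_family a (f0 w) by [].
have f0p g w : grmod_piece g w -> @fam_piece _ _ _ shift_family g (f0 w).
  by move=> /Gamma_piece[].
pose f := span_hom (F := shift_family) f0B f0Z f0p.
pose u0 (w : fam_sort graph_family) : I := w.2.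
have u0B : zmod_morphism u0 by [].
have u0Z g w a : @fam_piece _ _ _ graph_family g w -> u0 (fam_op a w) = a *: u0 w.
  by [].
have u0p g w : @fam_piece _ _ _ graph_family g w -> grmod_piece g (u0 w).
  by move=> /Gamma_piece[_]; rewrite mulgVK.
pose u := span_map (F := graph_family) u0B u0Z u0p.
have f_inj : injective f.
  suff f_ker w : f w = 0 -> w = 0.
    move=> w w' ff; apply/eqP; rewrite -subr_eq0; apply/eqP/f_ker.
    by rewrite grhomB ff subrr.
  move=> fw0; apply: (component_inj (grmod_sum (span_mod graph_family))) => g.
  set wg := LHS; rewrite (zmod_morphism0 (componentB (grmod_sum _) g)).
  have : f wg = 0.
    rewrite -component_hom fw0.
    exact: (zmod_morphism0 (componentB (grmod_sum _) g)).
  have : grmod_piece g wg by apply: component_piece (grmod_sum _) _ _.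
  move=> Gwg /(congr1 (@span_val _ _ _ _)) wg1; apply: span_val_inj.
  move: Gwg; rewrite /= /span_piece /= [span_val wg]surjective_pairing.
  by rewrite [(span_val wg).1]wg1 => /Gamma_fun ->.
have [v vf] := injI (f := f) u f_inj.
have one_piece : @fam_piece _ _ _ shift_family s 1.
  by rewrite /= mulgV; apply: gralg_piece1.
pose e : span_mod shift_family :=
  span_elt (internal_sum1 (@fam_sub _ _ _ shift_family) (P := setT) Logic.I one_piece).
exists (v e) => [|g a y Gw]; first exact: grhom_piece.
have Gw' : @fam_piece _ _ _ graph_family (g * s)%g (a, y) by rewrite /= mulgK.
pose w : span_mod graph_family :=
  span_elt (internal_sum1 (@fam_sub _ _ _ graph_family) (P := setT) Logic.I Gw').
have -> : y = u w by [].
rewrite -vf -linearZ; congr (v _); apply: span_val_inj => /=.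
by rewrite mulr1.
Qed.

End Baer.

Lemma acc_maximal (A : pzRingType) (P : set A -> Prop) (T : Type) (t0 : T)
    (J : T -> set A) :
  ascending_chain_condition P -> (forall t, P (J t)) ->
  exists t, forall u, J t `<=` J u -> J u `<=` J t.
Proof.
move=> acc PJ; apply: contrapT => /forallNP noMax.
have /choice[next nextP] t : exists u, J t `<=` J u /\ ~ J u `<=` J t.
  by have /existsNP[u /not_implyP uP] := noMax t; exists u.
have [N /(_ N.+1 (leqnSn N)) JN] : exists N, forall n, (N <= n)%N ->
    J (iter n next t0) = J (iter N next t0).
  apply: (acc (fun n => J (iter n next t0))) => // n.
  by have [] := nextP (iter n next t0).
by have [_] := nextP (iter N next t0); apply; rewrite -iterS JN.
Qed.

Lemma component_push (I : choiceType) (J : choiceType) (phi : I -> J)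
    (V : zmodType) (V_ : I -> set V) (dsV : internal_direct_sum V_) h i x :
  push_pieces phi V_ h x -> phi i != h -> component V_ i x = 0.
Proof.
move=> [s [c [us sh cV ->]]] ih; rewrite (componentE dsV) //.
by case: ifP => // /sh ih'; rewrite ih' eqxx in ih.
Qed.

Section RegradedBaer.
Variables (k : comPzRingType) (G G' : groupType).
Variables (phi : UMagmaMorphism.type G G') (A : grAlg k G) (I : grMod A).
Hypotheses (noethA : noetherian A) (injI : gr_injective I).
Variables (c : G') (T : G -> set (A^o * I)).
Local Notation A_ := (@gralg_piece k G A).
Local Notation I_ := (@grmod_piece k G A I).
Hypothesis T_sub : forall g, subgroup_closed (T g).
Hypothesis T_piece : forall g w, T g w ->
  A_ g w.1 /\ push_pieces phi I_ (phi g * c)%g w.2.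
Hypothesis T_scale : forall g h (b : A) w, A_ g b -> T h w -> T (g * h)%g (b *: w).
Hypothesis T_fun : forall g y, T g (0, y) -> y = 0.

Lemma regraded_unique g a y y' : T g (a, y) -> T g (a, y') -> y = y'.
Proof.
move=> Ty Ty'; apply/eqP; rewrite -subr_eq0; apply/eqP/(@T_fun g).
by rewrite -(subrr a); apply: (subgroupB (T_sub g) Ty Ty').
Qed.

(** T is the graph of a morphism from a graded left ideal to phi_!(I), which as a
    G-graded module is a sum of shifts of I: a value in degree g is made of
    components in degrees g s, and s is the index of the shift.  The ideal
    consists of the elements whose values only involve the shifts in l. *)
Definition bounded_ideal (l : seq G) : set A := [set a | forall g, exists2 y : I,
  T g (component A_ g a, y) & forall s, s \notin l -> component I_ (g * s)%g y = 0].

Lemma bounded_ideal_left l : left_ideal (bounded_ideal l).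
Proof.
have [As Is] := (gralg_sum A, grmod_sum I).
have sub : subgroup_closed (bounded_ideal l).
  split=> [g|a b Ja Jb g].
    exists 0 => [|s _]; last by rewrite (zmod_morphism0 (componentB Is _)).
    by rewrite (zmod_morphism0 (componentB As _)); apply: (subgroup0 (T_sub g)).
  have [y Ty y0] := Ja g; have [z Tz z0] := Jb g; exists (y - z) => [|s sl].
    by rewrite (componentB As); apply: (subgroupB (T_sub g) Ty Tz).
  by rewrite (componentB Is) y0 // z0 // subrr.
split=> // b a Ja; move: b; apply: (homogeneous_ind As).
  split=> [|b b' Jb Jb']; first by rewrite /= mul0r; apply: (subgroup0 sub).
  by rewrite /= mulrBl; apply: (subgroupB sub Jb Jb').
move=> h b Ab g; have [y Ty y0] := Ja (h^-1 * g)%g; exists (b *: y) => [|s sl].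
  rewrite -{2}(mulVKg h g) (component_mul _ _ Ab) -{1}(mulVKg h g).
  exact: T_scale Ty.
rewrite -{1}(mulVKg h g) -mulgA (component_scale _ _ Ab) y0 //.
exact: scaler0.
Qed.

(** If l gives a maximal bounded ideal, then adding to l the finitely many shifts
    that occur in the value at a does not enlarge that ideal, so a was already
    in it. *)
Lemma regraded_bounded : exists l : seq G, forall g a y s,
  T g (a, y) -> s \notin l -> component I_ (g * s)%g y = 0.
Proof.
have [As Is] := (gralg_sum A, grmod_sum I).
have [accA _] := noethA.
have [l maxl] := acc_maximal [::] accA bounded_ideal_left.
exists l => g a y s Ty sl.
pose l' := l ++ [seq (g^-1 * r)%g | r <- support_of Is y].
have Ja' : bounded_ideal l' a.
  have [Aa _] := T_piece Ty.
  move=> h; have [->|hg] := eqVneq h g.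
    exists y; first by rewrite (component_id As).
    move=> r; rewrite mem_cat => /norP[_ rl]; apply: (support_ofP (dsV := Is)).
    by apply: contra rl => rl; apply/mapP; exists (g * r)%g; rewrite ?mulKg.
  exists 0 => [|r _]; last by rewrite (zmod_morphism0 (componentB Is _)).
  by rewrite (component_neq As Aa) //; apply: (subgroup0 (T_sub h)).
have ll' : bounded_ideal l `<=` bounded_ideal l'.
  move=> b Jb h; have [z Tz z0] := Jb h; exists z => // r.
  by rewrite mem_cat => /norP[rl _]; apply: z0.
have [z + z0] := maxl _ ll' _ Ja' g.
have [Aa _] := T_piece Ty.
by rewrite (component_id As) // => Tz; rewrite (regraded_unique Ty Tz) z0.
Qed.

(** The map to each shift is extended separately by [graph_extend], and the sum of
    the resulting elements makes sense because it has finitely many terms. *)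
Lemma regraded_extend : exists2 x : I, push_pieces phi I_ c x &
  forall g (a : A) y, T g (a, y) -> y = a *: x.
Proof.
have [As Is] := (gralg_sum A, grmod_sum I).
have /choice[x_ x_P] s : exists x : I, I_ s x /\
    forall g (a : A) y, T g (a, y) -> component I_ (g * s)%g y = a *: x.
  pose Gamma g : set (A^o * I) :=
    [set w | exists2 y, T g (w.1, y) & w.2 = component I_ (g * s)%g y].
  have [||||x Ix xE] := @graph_extend k G A I injI s Gamma.
  - move=> g; split=> [|w w' [y Ty wE] [y' Ty' wE']].
      exists 0; first exact: (subgroup0 (T_sub g)).
      by rewrite (zmod_morphism0 (componentB Is _)).
    exists (y - y'); first exact: (subgroupB (T_sub g) Ty Ty').
    by rewrite (componentB Is) -wE -wE'.
  - move=> g w [y Ty ->]; have [Aw _] := T_piece Ty.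
    by split=> //; apply: component_piece Is _ _.
  - move=> g h b w Ab [y Ty wE]; exists (b *: y); first exact: T_scale Ty.
    by rewrite -mulgA (component_scale _ _ Ab) -wE.
  - move=> g z [y /T_fun -> /= ->].
    by rewrite (zmod_morphism0 (componentB Is _)).
  by exists x; split=> // g a y Ty; apply: (xE g); exists y.
have [l lP] := regraded_bounded.
pose l' := [seq s <- undup l | phi s == c].
have ul' : uniq l' by rewrite filter_uniq ?undup_uniq.
exists (\sum_(s <- l') x_ s) => [|g a y Ty].
  exists l', x_; split=> // [s|s]; last by have [] := x_P s.
  by rewrite mem_filter => /andP[/eqP].
have [Aa Iy] := T_piece Ty.
apply: (component_inj Is) => r; rewrite -(mulVKg g r).
rewrite (component_scale _ _ Aa) (componentE Is) //; last by move=> s; have [] := x_P s.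
set s := (_ * r)%g; rewrite mem_filter mem_undup.
case: eqP => [sc|/eqP sc] /=; last first.
  rewrite scaler0; apply: (component_push Is Iy).
  by rewrite gmulfM (inj_eq (mulgI _)).
case: ifP => [_|/negbT sl]; first by have [_ /(_ g a y Ty) ->] := x_P s.
by rewrite scaler0; apply: lP Ty sl.
Qed.

End RegradedBaer.

Section RegradedExtension.
Variables (k : comPzRingType) (G G' : groupType).
Variables (phi : UMagmaMorphism.type G G') (A : grAlg k G) (I : grMod A).
Hypotheses (noethA : noetherian A) (injI : gr_injective I).
Local Notation B := (push_alg phi A).
Local Notation X := (push_mod phi I).
Local Notation A_ := (@gralg_piece k G A).

Lemma push_piece_alg g (a : A) : A_ g a -> @gralg_piece k G' B (phi g) a.
Proof. exact: (internal_sum1 (@gralg_sub k G A)). Qed.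

Lemma push_scale (N : grMod B) g h (a : A) (n : N) :
  A_ g a -> grmod_piece h n -> grmod_piece (phi g * h)%g ((a : B) *: n).
Proof. by move=> Aa; apply: grmod_scale; apply: push_piece_alg. Qed.

(** The map w g, restricted to degree phi(g) t, is to be thought of as the degree
    g part of a morphism of G-graded modules from phi^*(M)(t) to phi^*(X)(t),
    and a partial extension of it to phi^*(N)(t) is recorded by its graph, a set
    of triples (g, (n, x)) with n and x of degree phi(g) t. *)
Variables (M N : grMod B) (f : grHom M N) (t : G').
Hypothesis f_inj : injective f.
Variable w : G -> M -> X.
Hypothesis wB : forall g, zmod_morphism (w g).
Hypothesis w_piece : forall g m,
  grmod_piece (phi g * t)%g m -> grmod_piece (phi g * t)%g (w g m).
Hypothesis w_scale : forall g h (a : B) m,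
  A_ g a -> w (g * h)%g (a *: m) = a *: w h m.

Local Notation T := (G * (N * X))%type.

Record partial_extension (R : set T) : Prop := PartialExtension {
  pe_piece : forall g v, R (g, v) ->
    grmod_piece (phi g * t)%g v.1 /\ grmod_piece (phi g * t)%g v.2;
  pe_sub : forall g, subgroup_closed [set v | R (g, v)];
  pe_scale : forall g h (a : B) v,
    A_ g a -> R (h, v) -> R ((g * h)%g, (a *: v.1, a *: v.2));
  pe_fun : forall g x, R (g, (0, x)) -> x = 0
}.

Definition initial_graph : set T := [set p | exists2 m,
  grmod_piece (phi p.1 * t)%g m & p.2 = (f m, w p.1 m)].

Lemma initial_graph_partial : partial_extension initial_graph.
Proof.
split=> [g v [m Mm /= ->]|g|g h a v Aa [m Mm /= ->]|g x [m Mm /= [fm0 ->]]].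
- by split; [apply: grhom_piece|apply: w_piece].
- split=> [|v v' [m Mm /= ->] [m' Mm' /= ->]].
    exists 0; first exact: (subgroup0 (grmod_sub _ _)).
    by rewrite /= (zmod_morphism0 (grhomB f)) (zmod_morphism0 (wB _)).
  exists (m - m'); first exact: (subgroupB (grmod_sub _ _) Mm Mm').
  by rewrite /= grhomB wB.
- exists (a *: m) => /=; last by rewrite linearZ w_scale.
  by rewrite gmulfM -mulgA; apply: push_scale.
suff -> : m = 0 by rewrite (zmod_morphism0 (wB _)).
by apply: f_inj; rewrite -fm0 (zmod_morphism0 (grhomB f)).
Qed.

Lemma maximal_partial_extension : exists R, [/\ partial_extension R,
  initial_graph `<=` R
  & forall R', partial_extension R' -> R `<=` R' -> R' `<=` R].
Proof.
(* The initial graph is kept out of D so that the empty chain has a bound. *)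
pose P := [set D : set T | partial_extension (initial_graph `|` D)].
have [F FP Ftot|D [PD maxD]] := @Zorn_bigcup T P; last first.
  exists (initial_graph `|` D); split=> // R' PR' DR'.
  have D_R' : D `<=` R' by apply: subset_trans DR'; apply: subsetUr.
  have P_R' : P R'.
    rewrite /P /= (_ : _ `|` _ = R') //; apply: setUidr.
    by apply: subset_trans DR'; apply: subsetUl.
  apply: contrapT => nR'D; apply: (maxD R') => //; split=> // R'D.
  by apply: nR'D; apply: subset_trans R'D _; apply: subsetUr.
rewrite /P /=; set U := initial_graph `|` _.
have U2 p q : U p -> U q -> exists D, [/\ partial_extension D, D p, D q & D `<=` U].
  have U1 D : F D -> initial_graph `|` D `<=` U.
    by move=> FD; apply: setUS; apply: bigcup_sup.
  move=> [p0|[D FD Dp]] [q0|[D' FD' Dq]].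
  - exists initial_graph; split=> //; [exact: initial_graph_partial|].
    exact: subsetUl.
  - by exists (initial_graph `|` D'); split; [exact: FP|left|right|exact: U1].
  - by exists (initial_graph `|` D); split; [exact: FP|right|left|exact: U1].
  have [DD'|D'D] := Ftot _ _ FD FD'.
    exists (initial_graph `|` D'); split; [exact: FP| | |exact: U1].
      by right; apply: DD'.
    by right.
  exists (initial_graph `|` D); split; [exact: FP| | |exact: U1].
    by right.
  by right; apply: D'D.
split=> [g v Uv|g|g h a v Aa Uv|g x Ux].
- by have [D [PD Dv _ _]] := U2 _ _ Uv Uv; apply: (pe_piece PD).
- split=> [|v v' Uv Uv'].
    by left; apply: (subgroup0 (pe_sub initial_graph_partial g)).
  have [D [PD Dv Dv' DU]] := U2 _ _ Uv Uv'.
  exact/DU/(subgroupB (pe_sub PD g) Dv Dv').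
- have [D [PD Dv _ DU]] := U2 _ _ Uv Uv.
  exact/DU/(pe_scale PD Aa Dv).
have [D [PD Dx _ _]] := U2 _ _ Ux Ux; exact: (pe_fun PD Dx).
Qed.

(** A partial extension R can be enlarged at n0: the multiples of n0 that it
    covers define a morphism from a graded left ideal, which by
    [regraded_extend] is multiplication by some x0, and n0 is sent to x0. *)
Lemma maximal_total R : partial_extension R ->
  (forall R', partial_extension R' -> R `<=` R' -> R' `<=` R) ->
  forall g n, grmod_piece (phi g * t)%g n -> exists x, R (g, (n, x)).
Proof.
move=> [Rp Rs Rm Rf] maxR g0 n0 Nn0.
pose S g : set (A^o * I) :=
  [set v | A_ g v.1 /\ R ((g * g0)%g, ((v.1 : B) *: n0, v.2))].
have [||||x0 Xx0 x0E] := regraded_extend (phi := phi) noethA injI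
  (c := (phi g0 * t)%g) (T := S).
- move=> g; split=> [|v v' [Av Rv] [Av' Rv']]; split.
  + exact: (subgroup0 (@gralg_sub k G A g)).
  + by rewrite /= scale0r; apply: (subgroup0 (Rs _)).
  + exact: (subgroupB (@gralg_sub k G A g) Av Av').
  + by rewrite /= scalerBl; apply: (subgroupB (Rs _) Rv Rv').
- move=> g v [Av Rv]; split=> //; have [_ /=] := Rp _ _ Rv.
  by rewrite gmulfM mulgA.
- move=> g h b v Ab [Av Rv]; split; first exact: gralg_mul.
  have := Rm _ _ _ _ Ab Rv; rewrite mulgA /=.
  by rewrite scalerA.
- by move=> g y [_]; rewrite /= scale0r => /Rf.
pose R' : set T := [set p | exists v, exists2 a : B,
  R (p.1, v) /\ A_ (p.1 * g0^-1)%g a & p.2 = (v.1 + a *: n0, v.2 + a *: (x0 : X))].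
exists x0; apply: (maxR R').
- split=> [g _ [v [a [/= Rv Aa] /= ->]]|g|g h a _ Aa [v [b [/= Rv Ab] /= ->]]
    |g x [v [a [/= Rv Aa] [/esym va0 ->]]]].
  + have [Nv Xv] := Rp _ _ Rv.
    have gE : (phi g * t = phi (g * g0^-1) * (phi g0 * t))%g.
      by rewrite mulgA -gmulfM mulgVK.
    split; [apply: (subgroupD (grmod_sub _ _)) Nv _
      |apply: (subgroupD (grmod_sub _ _)) Xv _];
      by rewrite gE; apply: push_scale.
  + split=> [|_ _ [v [a [/= Rv Aa] /= ->]] [v' [a' [/= Rv' Aa'] /= ->]]].
      exists 0; exists 0; last by rewrite !scale0r !addr0.
      by split; [exact: (subgroup0 (Rs g))|exact: (subgroup0 (@gralg_sub k G A _))].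
    exists (v - v'), (a - a').
      split; first exact: (subgroupB (Rs g) Rv Rv').
      exact: (subgroupB (@gralg_sub k G A _) Aa Aa').
    by rewrite /= !scalerBl; congr pair; rewrite /= opprD addrACA.
  + exists (a *: v.1, a *: v.2), ((a : A) * b).
      by split; [exact: Rm|rewrite /= -mulgA; apply: gralg_mul].
    by rewrite /= !scalerDr !scalerA.
  + have : S (g * g0^-1)%g (a, - v.2).
      split=> //=; rewrite mulgVK.
      have -> : a *: n0 = - v.1 by apply/eqP; rewrite -addr_eq0 addrC va0.
      by apply: (subgroupN (Rs g)).
    by move=> /x0E <-; rewrite subrr.
- move=> [g v] Rv; exists v, 0; last by rewrite !scale0r !addr0; case: (v).
  by split=> //; apply: (subgroup0 (@gralg_sub k G A _)).
exists 0, 1; last by rewrite /= !scale1r !add0r.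
split; first exact: (subgroup0 (Rs g0)).
by rewrite /= mulgV; apply: gralg_piece1.
Qed.

(** That is, phi^*(phi_!(I))(t) is injective relative to the inclusions that come
    from G'-graded modules. *)
Lemma regraded_family_extension : exists r : G -> N -> X, [/\
  forall g, zmod_morphism (r g),
  forall g h n, grmod_piece h n ->
    if h == (phi g * t)%g then grmod_piece h (r g n) else r g n = 0,
  forall g h (a : B) n, A_ g a -> r (g * h)%g (a *: n) = a *: r h n
  & forall g m, grmod_piece (phi g * t)%g m -> r g (f m) = w g m].
Proof.
have [R [PR R0 maxR]] := maximal_partial_extension.
have [Ns Rtot] := (grmod_sum N, maximal_total PR maxR).
pose pr g n := component (@grmod_piece _ _ _ N) (phi g * t)%g n.
have /choice[r0 r0P] (p : G * N) : exists x, R (p.1, (pr p.1 p.2, x)).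
  by apply: Rtot; apply: component_piece.
have Runiq g n x x' : R (g, (n, x)) -> R (g, (n, x')) -> x = x'.
  move=> Rx Rx'; apply/eqP; rewrite -subr_eq0; apply/eqP/(pe_fun PR (g := g)).
  by rewrite -(subrr n); apply: (subgroupB (pe_sub PR g) Rx Rx').
pose r g n := r0 (g, n).
have rP g n : R (g, (pr g n, r g n)) by apply: (r0P (g, n)).
exists r; split=> [g n n'|g h n Nn|g h a n Aa|g m Mm].
- apply: (Runiq g (pr g (n - n'))); first exact: rP.
  by rewrite /pr (componentB Ns); apply: (subgroupB (pe_sub PR g) (rP g n) (rP g n')).
- have := rP g n; rewrite /pr; case: eqP => [->|/eqP hg].
    by move=> /(pe_piece PR)[].
  by rewrite (component_neq Ns Nn) 1?eq_sym // => /(pe_fun PR).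
- apply: (Runiq (g * h)%g (pr (g * h)%g (a *: n))); first exact: rP.
  rewrite /pr gmulfM -mulgA (component_scale _ _ (push_piece_alg Aa)).
  exact: (pe_scale PR Aa (rP h n)).
apply: (Runiq g (f m)); last by apply: R0; exists m.
have := rP g (f m); rewrite /pr (component_id Ns) //.
exact: grhom_piece.
Qed.

End RegradedExtension.

(** * Coinduction from the base ring to the group algebra *)

Section GroupAlgebraFacts.
Variables (k : comPzRingType) (G : groupType).
Local Notation kG := (group_algebra k G).

Definition group_unit (g : G) : kG := << 1 *g g >>.

Lemma group_unitM g h : group_unit (g * h)%g = group_unit g * group_unit h.
Proof. by rewrite [RHS]convUU mulr1. Qed.

Lemma group_unit1 : group_unit 1%g = 1. Proof. by []. Qed.

Lemma group_monomialE c g : (<< c *g g >> : kG) = group_algebra_map G c * group_unit g.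
Proof. by rewrite [RHS]convUU mulr1 mul1g. Qed.

Lemma group_algebra_ext (V : zmodType) (w w' : kG -> V) :
  zmod_morphism w -> zmod_morphism w' ->
  (forall c g, w (group_algebra_map G c * group_unit g)
             = w' (group_algebra_map G c * group_unit g)) -> w =1 w'.
Proof.
move=> wB wB' ww'; apply: (homogeneous_ext (group_sum k G)) => // g _ [c ->].
by rewrite group_monomialE.
Qed.

(** The group algebra is free over the base ring on the group elements. The
    k-module structure of V is passed as a function sc since V is typically an
    A-module, or a group of functions into one. *)
Lemma group_algebra_free (V : zmodType) (sc : k -> V -> V) (v : G -> V) :
  (forall c, zmod_morphism (sc c)) -> (forall x, zmod_morphism (sc^~ x)) ->
  (forall c d x, sc c (sc d x) = sc (c * d) x) -> (forall x, sc 1 x = x) ->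
  exists w : kG -> V, [/\ zmod_morphism w,
    forall c b, w (group_algebra_map G c * b) = sc c (w b)
    & forall g, w (group_unit g) = v g].
Proof.
move=> scB scBl scA sc1.
have bB g : zmod_morphism (fun b : kG => sc (mcoeff g b) (v g)).
  by move=> b b'; rewrite mcoeffB scBl.
pose w := extend (group_sum k G) (fun g (b : kG) => sc (mcoeff g b) (v g)).
have wB : zmod_morphism w by apply: extendB.
have wU c g : w (group_algebra_map G c * group_unit g) = sc c (v g).
  have Gc : group_piece g << c *g g >> by exists c.
  by rewrite -group_monomialE /w (extend_piece _ bB Gc) mcoeffUU.
exists w; split=> // [c b|g].
  move: b; apply: group_algebra_ext => [b b'|b b'|d g].
  - by rewrite mulrBr wB.
  - by rewrite wB scB.
  by rewrite mulrA -rmorphM !wU scA.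
by have := wU 1 g; rewrite rmorph1 mul1r sc1.
Qed.

End GroupAlgebraFacts.

Section Coinduction.
Variables (k : comPzRingType) (G G' : groupType).
Variable phi : UMagmaMorphism.type G G'.
Local Notation kG := (group_algebra k G).
Local Notation grG := (push_alg phi (group_gralg k G)).

Section CoinducedFamily.
Variables (V : zmodType) (C : G' -> set (kG -> V)).

(** Families of subgroups of functions on the group algebra that form a graded
    module for the action (a w)(b) = w(b a). *)
Record coinduced : Prop := Coinduced {
  coind_sub : forall t, subgroup_closed (C t);
  coind_independent : independent C;
  coind_additive : forall t w, C t w -> zmod_morphism w;
  coind_translate : forall h t (a : grG) w, gralg_piece h a -> C t w ->
    C (h * t)%g (fun b => w (b * a))
}.

Hypothesis coindC : coinduced.

Definition coind_family : gradedFamily grG.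
Proof.
apply: (@GradedFamily k G' grG (kG -> V) (fun a w b => w (b * (a : kG))) C).
- exact: coind_sub coindC.
- exact: coind_independent coindC.
- by [].
- by move=> a b w; apply: funext => c; rewrite -mulrA.
- by move=> w; apply: funext => b; rewrite mulr1.
- move=> t w Cw a b; apply: funext => c; rewrite mulrDr.
  exact: (zmod_morphismD (coind_additive coindC Cw)).
- by move=> h t a w; apply: coind_translate.
Defined.

End CoinducedFamily.

(** By evaluation at 1, a morphism from P to a coinduced module is a map from P
    to V, and conversely q corresponds to the morphism sending p to the
    function b |-> q(b p).  Projectivity of P therefore lifts maps to V' along
    rho, once rho is surjective on the coinduced modules. *)
Lemma coind_lift (P : grMod grG) (projP : gr_projective P) (V V' : zmodType)
    (C : G' -> set (kG -> V)) (C' : G' -> set (kG -> V')) (rho : V -> V') :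
  coinduced C -> coinduced C' -> zmod_morphism rho ->
  (forall t w, C t w -> C' t (rho \o w)) ->
  (forall t w', C' t w' -> exists2 w, C t w & rho \o w = w') ->
  forall q : P -> V', zmod_morphism q ->
  (forall t (p : P), grmod_piece t p -> C' t (fun b => q ((b : grG) *: p))) ->
  exists r : P -> V, [/\ zmod_morphism r, forall p, rho (r p) = q p
    & forall t (p : P), grmod_piece t p -> C t (fun b => r ((b : grG) *: p))].
Proof.
move=> cC cC' rhoB rhoC rho_surj q qB qC.
pose F := coind_family cC; pose F' := coind_family cC'.
pose f0 (w : span_mod F) : kG -> V' := rho \o span_val w.
have f0B : zmod_morphism f0 by move=> w w'; apply: funext => b; apply: rhoB.
have f0p t w : grmod_piece t w -> @fam_piece _ _ _ F' t (f0 w) by apply: rhoC.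
pose f := span_hom (F := F') f0B (fun a w => erefl) f0p.
pose u0 (p : P) : kG -> V' := fun b => q ((b : grG) *: p).
have u0B : zmod_morphism u0.
  by move=> p p'; apply: funext => b; rewrite /u0 scalerBr qB.
have u0Z a p : u0 (a *: p) = @fam_op _ _ _ F' a (u0 p).
  by apply: funext => b; rewrite /u0 scalerA.
pose u := span_hom (F := F') u0B u0Z qC.
have f_surj : forall y, exists x, f x = y.
  apply: (homogeneous_ind (span_sum F')).
    split=> [|_ _ [x <-] [y <-]]; last by exists (x - y); rewrite grhomB.
    by exists 0; rewrite (zmod_morphism0 (grhomB f)).
  move=> t y C'y; have [w Cw wE] := rho_surj _ _ C'y.
  by exists (span_elt (internal_sum1 (@fam_sub _ _ _ F) (P := setT) Logic.I Cw));
    apply: span_val_inj.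
have [v fv] := projP _ _ f u f_surj.
pose r p := span_val (v p) 1.
have rE p : (fun b : kG => r ((b : grG) *: p)) = span_val (v p).
  apply: funext => b; rewrite /r linearZ /=.
  by rewrite mul1r.
exists r; split=> [p p'|p|t p Pp]; first by rewrite /r grhomB.
  by have /(congr1 (fun y : span_mod F' => span_val y 1)) := fv p; rewrite /= /f0 /u0 /= scale1r.
by rewrite rE; apply: (grhom_piece v Pp).
Qed.

Section CoinducedPiece.
Variables (V : zmodType) (sc : k -> V -> V) (S_ : G' -> set V).
Variable E : set (kG -> V).
Hypothesis scB : forall c, zmod_morphism (sc c).
Hypothesis S_sub : forall h, subgroup_closed (S_ h).
Hypothesis S_independent : independent S_.
Hypothesis S_sc : forall h c v, S_ h v -> S_ h (sc c v).
Hypothesis E_sub : subgroup_closed E.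
Hypothesis E_translate : forall w (a : kG), E w -> E (fun b => w (b * a)).

(** The degree t part of the module coinduced from the graded k-module V with
    pieces S_ h: a k-linear function on kG, determined by its values on G, whose
    value at g has degree phi(g) t.  The set E leaves room for one more
    invariant condition, since V will also be a group of maps that should be
    linear over a graded algebra. *)
Definition coind_piece t : set (kG -> V) := [set w | [/\ zmod_morphism w,
  forall c b, w (group_algebra_map G c * b) = sc c (w b),
  forall g, S_ (phi g * t)%g (w (group_unit k g)) & E w]].

Lemma coind_pieceP : coinduced coind_piece.
Proof.
split=> [t|s w us wC w0 t ts|t w []|h t a w] //.
- split=> [|w w' [wB wZ wS wE] [wB' wZ' wS' wE']].
    split=> [b b'|c b|g|]; first by rewrite subrr.
    + by rewrite (zmod_morphism0 (scB c)).
    + exact: (subgroup0 (S_sub _)).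
    + exact: (subgroup0 E_sub).
  split=> [b b'|c b|g|].
  + by rewrite !fctE wB wB' !opprD !opprK addrACA.
  + by rewrite !fctE wZ wZ' scB.
  + exact: (subgroupB (S_sub _)).
  + exact: (subgroupB E_sub).
- apply: funext; have [wB wZ _ _] := wC t.
  apply: group_algebra_ext => // [b b'|c g]; first by rewrite subrr.
  rewrite wZ; suff -> : w t (group_unit k g) = 0 by rewrite (zmod_morphism0 (scB c)).
  rewrite -(mulKg (phi g) t).
  apply: (S_independent (s := [seq phi g * h | h <- s]%g)
    (c := fun h => w ((phi g)^-1 * h)%g (group_unit k g))).
  + by rewrite map_inj_uniq //; apply: mulgI.
  + by move=> h; have [_ _ /(_ g)] := wC ((phi g)^-1 * h)%g; rewrite mulVKg.
  + rewrite big_map; under eq_bigr => h _ do rewrite mulKg.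
    by have /(congr1 (fun v => v (group_unit k g))) := w0; rewrite fct_sumE.
  + by apply/mapP; exists t.
move=> [l [c [_ lh ca ->]]] [wB wZ wS wE]; split=> [b b'|d b|g|].
+ by rewrite mulrBl wB.
+ by rewrite -mulrA wZ.
+ rewrite mulr_sumr (zmod_morphism_sum wB).
  apply: subgroup_sum => // s sl; have [d ->] := ca s.
  rewrite group_monomialE mulrA -group_algebra_central -mulrA -group_unitM wZ.
  by apply: S_sc; rewrite -(lh _ sl) mulgA -gmulfM; apply: wS.
exact: E_translate.
Qed.

End CoinducedPiece.

End Coinduction.

(** * The internal Hom out of a graded module over the group algebra *)

Section HomPiece.
Variables (J : choiceType) (M X : zmodType) (M_ : J -> set M) (X_ : J -> set X).
Hypotheses (dsM : internal_direct_sum M_) (X_sub : forall h, subgroup_closed (X_ h)).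

(** Hom(M_h, X_h), seen as the maps that vanish on the other pieces. *)
Definition hom_piece h : set (M -> X) := [set y | zmod_morphism y /\
  forall h' m, M_ h' m -> if h' == h then X_ h' (y m) else y m = 0].

Lemma hom_piece_sub h : subgroup_closed (hom_piece h).
Proof.
split=> [|y y' [yB yp] [yB' yp']].
  split=> [m m'|h' m Mm]; first by rewrite subrr.
  by case: ifP => // _; apply: (subgroup0 (X_sub _)).
split=> [m m'|h' m Mm]; first by rewrite !fctE yB yB' !opprD !opprK addrACA.
have := yp _ _ Mm; have := yp' _ _ Mm; rewrite !fctE; case: ifP => _.
  by move=> Xy' Xy; apply: (subgroupB (X_sub _)).
by move=> -> ->; rewrite subrr.
Qed.

Lemma hom_piece_independent : independent hom_piece.
Proof.
move=> s y us yp y0 h hs; apply: funext; have [yB _] := yp h.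
apply: (homogeneous_ext dsM) => // [m m'|h' m Mm]; first by rewrite subrr.
have other l : l != h' -> y l m = 0.
  by move=> /negbTE lh; have [_ /(_ _ _ Mm)] := yp l; rewrite eq_sym lh.
have [hh'|/other//] := eqVneq h h'.
have /(congr1 (fun v => v m)) := y0; rewrite fct_sumE (bigD1_seq h) //=.
rewrite big1 ?addr0 // => l lh; apply: other.
by rewrite -hh'.
Qed.

End HomPiece.

Section InternalHom.
Variables (k : comPzRingType) (G G' : groupType).
Variables (phi : UMagmaMorphism.type G G') (A : grAlg k G).
Local Notation kG := (group_algebra k G).
Local Notation grG := (push_alg phi (group_gralg k G)).
Local Notation B := (push_alg phi A).
Local Notation A_ := (@gralg_piece k G A).
Local Notation u := (@group_unit k G).
Local Notation iota := (group_algebra_map G).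

Lemma group_unit_scale (P : grMod grG) g h (p : P) :
  grmod_piece h p -> grmod_piece (phi g * h)%g ((u g : grG) *: p).
Proof.
by move=> Pp; apply: (@push_scale k G G' phi (group_gralg k G)) => //; exists 1.
Qed.

Lemma group_unit_scaleV (P : grMod grG) g h (p : P) :
  grmod_piece h p -> grmod_piece ((phi g)^-1 * h)%g ((u g^-1 : grG) *: p).
Proof.
suff -> : ((phi g)^-1 = phi g^-1)%g by apply: group_unit_scale.
by apply: (mulgI (phi g)); rewrite mulgV -gmulfM mulgV gmulf1.
Qed.

Section Object.
Variables (P : grMod grG) (X : grMod B).

(** The action (a y)(p) = sum over g of a_g y(g^-1 p), which preserves degrees as
    a_g maps X_h to X_(phi(g) h). *)
Definition hom_op (a : A) (y : P -> X) (p : P) : X :=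
  extend (gralg_sum A) (fun g b => (b : B) *: y ((u g^-1 : grG) *: p)) a.

Lemma hom_opB p y : zmod_morphism (fun a => hom_op a y p).
Proof. by apply: extendB => g a b; rewrite scalerBl. Qed.

Lemma hom_opE g a y p : A_ g a ->
  hom_op a y p = (a : B) *: y ((u g^-1 : grG) *: p).
Proof.
move=> Aa; rewrite /hom_op (extend_piece _ _ Aa) // => h b c.
by rewrite scalerBl.
Qed.

Lemma hom_op_subr a : zmod_morphism (hom_op a).
Proof.
move=> y y'; apply: funext => p.
transitivity (hom_op a y p - hom_op a y' p) => //; move: a.
apply: (homogeneous_ext (gralg_sum A)) => [a b|a b|g a Aa].
- exact: hom_opB.
- by rewrite !hom_opB !opprD !opprK addrACA.
by rewrite !(hom_opE _ _ Aa) scalerBr.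
Qed.

Lemma hom_opA a b y : hom_op a (hom_op b y) = hom_op (a * b) y.
Proof.
apply: funext => p; move: a; apply: (homogeneous_ext (gralg_sum A)).
- by move=> a c; apply: hom_opB.
- by move=> a c; rewrite mulrBl hom_opB.
move=> g a Aa; rewrite (hom_opE _ _ Aa); move: b.
apply: (homogeneous_ext (gralg_sum A)) => [b c|b c|h b Ab].
- by rewrite hom_opB scalerBr.
- by rewrite mulrBr hom_opB.
rewrite (hom_opE _ _ Ab) (hom_opE _ _ (gralg_mul Aa Ab)) scalerA invgM.
by rewrite group_unitM; congr (_ *: y _); rewrite scalerA.
Qed.

Lemma hom_op1 y : hom_op 1 y = y.
Proof.
apply: funext => p; rewrite (hom_opE _ _ (gralg_piece1 A)) invg1 scale1r.
by rewrite group_unit1 scale1r.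
Qed.

Definition khom_piece h : set (P -> X) :=
  [set y | hom_piece (@grmod_piece _ _ _ P) (@grmod_piece _ _ _ X) h y
    /\ forall c (p : P), y ((iota c : grG) *: p) = (kalg_map A c : B) *: y p].

Lemma khom_piece_sub h : subgroup_closed (khom_piece h).
Proof.
have sub := hom_piece_sub (@grmod_piece _ _ _ P) (@grmod_sub _ _ _ X) h.
split=> [|y y' [Hy yZ] [Hy' yZ']].
  by split=> [|c p]; [exact: (subgroup0 sub)|rewrite scaler0].
split=> [|c p]; first exact: (subgroupB sub Hy Hy').
by rewrite !fctE yZ yZ' scalerBr.
Qed.

Lemma khom_piece_op h h' (a : B) y : gralg_piece h a -> khom_piece h' y ->
  khom_piece (h * h')%g (hom_op a y).
Proof.
move=> [s [c [_ sh cA ->]]] Hy.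
rewrite (big_morph (hom_op^~ y) (id1 := 0) (op1 := +%R)); first last.
- by apply: funext => p; apply: (zmod_morphism0 (hom_opB p y)).
- by move=> b b'; apply: funext => p; apply: (zmod_morphismD (hom_opB p y)).
apply: subgroup_sum => [|g gs]; first exact: khom_piece_sub.
rewrite -(sh _ gs); move: (c g) (cA g) => {}a Aa {s c sh cA gs h}.
have [[yB yp] yZ] := Hy; split; first split=> [p p'|h p Pp].
- by rewrite !(hom_opE _ _ Aa) scalerBr yB scalerBr.
- rewrite (hom_opE _ _ Aa); have := yp _ _ (group_unit_scaleV g Pp).
  rewrite -(inj_eq (mulgI (phi g))) mulVKg; case: ifP => _; last first.
    by move=> ->; rewrite scaler0.
  by move=> Xy; rewrite -(mulVKg (phi g) h); apply: push_scale.
move=> d p; rewrite !(hom_opE _ _ Aa).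
have -> : (u g^-1 : grG) *: ((iota d : grG) *: p)
    = (iota d : grG) *: ((u g^-1 : grG) *: p).
  by rewrite !scalerA; congr (_ *: p); apply/esym/group_algebra_central.
by rewrite yZ !scalerA; congr (_ *: _); apply/esym/kalg_central.
Qed.

Definition hom_family : gradedFamily B.
Proof.
apply: (@GradedFamily k G' B (P -> X) hom_op khom_piece).
- exact: khom_piece_sub.
- move=> s y us Hy; apply: (hom_piece_independent (grmod_sum P)
    (X_ := @grmod_piece _ _ _ X)) us _ => h.
  by have [] := Hy h.
- exact: hom_op_subr.
- exact: hom_opA.
- exact: hom_op1.
- move=> h y _ a b; apply: funext => p; exact: (zmod_morphismD (hom_opB p y)).
- exact: khom_piece_op.
Defined.

Definition internal_hom : grMod B := span_mod hom_family.

End Object.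

Section Element.
Variables (P : grMod grG) (X : grMod B) (y : internal_hom P X).

Lemma internal_hom_additive : zmod_morphism (span_val y).
Proof.
move: (span_val y) (span_valP y); apply: span_ind => [|h z [[zB _] _]] //.
split=> [p p'|z z' zB zB' p p']; first by rewrite subrr.
by rewrite !fctE zB zB' !opprD !opprK addrACA.
Qed.

Lemma internal_hom_klinear c (p : P) :
  span_val y ((iota c : grG) *: p) = (kalg_map A c : B) *: span_val y p.
Proof.
move: (span_val y) (span_valP y); apply: span_ind => [|h z [_ zZ]] //.
split=> [|z z' zZ zZ'] /=; first by rewrite scaler0.
by rewrite !fctE zZ zZ' scalerBr.
Qed.

End Element.

(** The module Q(M, X) for which morphisms from M to the internal Hom of P and X
    are morphisms from P to Q(M, X).  An element w of degree t is determined by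
    the maps w(g) from M_(phi(g) t) to X_(phi(g) t), and equivariance says that
    these maps commute with the action of A on the G-graded modules phi^*(M)(t)
    and phi^*(X)(t). *)
Section Curry.
Variables (M X : grMod B).

Definition curry_equivariant : set (kG -> M -> X) :=
  [set w | forall g (a : B) b m, A_ g a -> w (u g * b) (a *: m) = a *: w b m].

Definition curry_piece : G' -> set (kG -> M -> X) :=
  coind_piece phi (fun c y m => (kalg_map A c : B) *: y m)
    (hom_piece (@grmod_piece _ _ _ M) (@grmod_piece _ _ _ X)) curry_equivariant.

Lemma curry_pieceP : coinduced phi curry_piece.
Proof.
apply: coind_pieceP => [c y y'|h||||w a Ew].
- by apply: funext => m; rewrite !fctE scalerBr.
- exact/hom_piece_sub/grmod_sub.
- exact: (hom_piece_independent (grmod_sum M)).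
- move=> h c y [yB yp]; split=> [m m'|h' m Mm]; first by rewrite yB scalerBr.
  have := yp _ _ Mm; case: ifP => _; last by move=> ->; rewrite scaler0.
  exact: grmod_piece_map.
- split=> [g a b m _|w w' Ew Ew' g a b m Aa]; first by rewrite scaler0.
  by rewrite !fctE Ew // Ew' // scalerBr.
by move=> g b c m Ab; rewrite -mulrA Ew.
Qed.

End Curry.

Section Injectivity.
Variable I : grMod A.
Hypotheses (noethA : noetherian A) (injI : gr_injective I).
Local Notation X := (push_mod phi I).

(** Surjectivity of Q(N, X) -> Q(M, X), that is, [regraded_family_extension] after
    k-linear extension from G to kG. *)
Lemma curry_extension (M N : grMod B) (f : grHom M N) : injective f ->
  forall t w, @curry_piece M X t w ->
  exists2 w', @curry_piece N X t w' & (fun b => w' b \o f) = w.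
Proof.
move=> f_inj t w [wB wZ wp wE].
have wBm g : zmod_morphism (w (u g)) by have [] := wp g.
have wpm g m : grmod_piece (phi g * t)%g m -> grmod_piece (phi g * t)%g (w (u g) m).
  by move=> Mm; have [_ /(_ _ _ Mm)] := wp g; rewrite eqxx.
have wEm g h (a : B) m : A_ g a -> w (u (g * h)%g) (a *: m) = a *: w (u h) m.
  by move=> Aa; rewrite group_unitM wE.
have [r [rB rp rE rf]] :=
  regraded_family_extension noethA injI f_inj wBm wpm wEm.
have [||||w' [w'B w'Z w'u]] := @group_algebra_free k G (N -> X)
  (fun c y n => (kalg_map A c : B) *: y n) r.
- by move=> c y y'; apply: funext => n; rewrite !fctE scalerBr.
- by move=> y c c'; apply: funext => n; rewrite rmorphB scalerBl.
- by move=> c d y; apply: funext => n; rewrite rmorphM scalerA.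
- by move=> y; apply: funext => n; rewrite rmorph1 scale1r.
have rfm g m : r g (f m) = w (u g) m.
  move: m; apply: (homogeneous_ext (grmod_sum M)) => [m m'||h m Mm] //.
    by rewrite grhomB rB.
  have [hg|/negbTE hg] := eqVneq h (phi g * t)%g; first by rewrite rf // -hg.
  have := rp g _ _ (grhom_piece f Mm); rewrite hg => ->.
  by have [_ /(_ _ _ Mm)] := wp g; rewrite hg.
exists w'; last first.
  apply: funext; apply: group_algebra_ext => // [b b'|c g]; first by rewrite w'B.
  by apply: funext => m; rewrite w'Z w'u wZ /= rfm.
split=> // [g|g a b n Aa]; first by rewrite w'u; split=> // h n Nn; apply: rp.
move: b; apply: group_algebra_ext => [b b'|b b'|c h].
- by rewrite mulrBr w'B.
- by rewrite w'B !fctE scalerBr.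
rewrite mulrA -group_algebra_central -mulrA -group_unitM !w'Z !w'u rE //.
by rewrite !scalerA kalg_central.
Qed.

(** To extend a morphism from M to Hom(P, X) along f, curry it into a map from P
    to Q(M, X), lift this map to Q(N, X) by projectivity of P, and uncurry. *)
Lemma internal_hom_injective (P : grMod grG) :
  gr_projective P -> gr_injective (internal_hom P X).
Proof.
move=> projP M N f u0 f_inj.
pose q (p : P) : M -> X := fun m => span_val (u0 m) p.
have qB : zmod_morphism q.
  by move=> p p'; apply: funext => m; apply: internal_hom_additive.
have qC t (p : P) : grmod_piece t p ->
    @curry_piece M X t (fun b => q ((b : grG) *: p)).
  move=> Pp; split=> [b b'|c b|g|g a b m Aa].
  - by rewrite scalerBl qB.
  - apply: funext => m; rewrite /q -internal_hom_klinear scalerA.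
    by [].
  - split=> [m m'|h m Mm]; first by rewrite /q grhomB.
    have [[_ /(_ _ _ (group_unit_scale g Pp)) qm] _] := grhom_piece u0 Mm.
    by rewrite eq_sym; case: eqP qm => // ->.
  have ub : u g^-1 * (u g * b) = b by rewrite mulrA -group_unitM mulVg mul1r.
  by rewrite /q linearZ [LHS](hom_opE _ _ Aa) scalerA [X in X *: p]ub.
have rhoB : zmod_morphism (fun y : N -> X => y \o f) by [].
have [||r [rB rf rC]] := coind_lift projP (curry_pieceP N X) (curry_pieceP M X)
  rhoB _ _ qB qC.
- move=> t w [wB wZ wp wE]; split=> [b b'|c b|g|g a b m Aa].
  + by rewrite /= wB.
  + by rewrite /= wZ.
  + have [yB yp] := wp g; split=> [m m'|h m Mm]; first by rewrite /= grhomB yB.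
    by apply: yp; apply: grhom_piece.
  by rewrite /= linearZ wE.
- by move=> t w Cw; apply: curry_extension.
have r_lin p : zmod_morphism (r p).
  move: p; apply: (homogeneous_ind (grmod_sum P)) => [|t p Pp].
    split=> [n n'|p p' rp rp' n n'].
      by rewrite (zmod_morphism0 rB) subrr.
    by rewrite rB !fctE rp rp' !opprD !opprK addrACA.
  have [_ _ /(_ 1%g) [yB _] _] := rC _ _ Pp.
  by move: yB; rewrite group_unit1 scale1r.
have rZ c p : r ((iota c : grG) *: p) = fun n => (kalg_map A c : B) *: r p n.
  move: p; apply: (homogeneous_ext (grmod_sum P)) => [p p'|p p'|t p Pp].
  - by rewrite scalerBr rB.
  - by apply: funext => n; rewrite rB !fctE scalerBr.
  by have [_ /(_ c 1) + _ _] := rC _ _ Pp; rewrite mulr1 scale1r.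
have rE g (a : B) p n : A_ g a -> r ((u g : grG) *: p) (a *: n) = a *: r p n.
  move=> Aa; move: p; apply: (homogeneous_ext (grmod_sum P)) => [p p'|p p'|t p Pp].
  - by rewrite scalerBr rB.
  - by rewrite rB !fctE scalerBr.
  by have [_ _ _ /(_ g a 1 n Aa)] := rC _ _ Pp; rewrite mulr1 scale1r.
have rp h p : grmod_piece h p -> forall h' n, grmod_piece h' n ->
    if h == h' then grmod_piece h' (r p n) else r p n = 0.
  move=> Pp h' n Nn; have [_ _ /(_ 1%g) [_ /(_ _ _ Nn) rn] _] := rC _ _ Pp.
  by move: rn; rewrite group_unit1 scale1r gmulf1 mul1g eq_sym.
pose v0 n : P -> X := fun p => r p n.
have v0B : zmod_morphism v0.
  by move=> n n'; apply: funext => p; rewrite /v0 r_lin.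
have v0Z (a : B) n : v0 (a *: n) = hom_op a (v0 n).
  apply: funext => p; move: a; apply: (homogeneous_ext (gralg_sum A)) => [a b|a b|g a Aa].
  - by rewrite /v0 scalerBl r_lin.
  - exact: hom_opB.
  rewrite (hom_opE _ _ Aa) /v0 -(rE g a _ n Aa) scalerA -group_unitM.
  by rewrite mulgV group_unit1 scale1r.
have v0p h n : grmod_piece h n -> khom_piece h (v0 n).
  move=> Nn; split=> [|c p]; last by rewrite /v0 rZ.
  split=> [p p'|h' p Pp]; first by rewrite /v0 rB.
  by have := rp _ _ Pp _ _ Nn; case: eqP => // ->.
exists (span_hom (F := hom_family P X) v0B v0Z v0p) => m.
by apply: span_val_inj; apply: funext => p; have /(congr1 (fun y => y m)) := rf p.
Qed.

End Injectivity.

End InternalHom.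

(** * Splitting over the base ring *)

Section Splitting.
Variables (k : comPzRingType) (G G' : groupType).
Variable phi : UMagmaMorphism.type G G'.
Local Notation kG := (group_algebra k G).
Local Notation grG := (push_alg phi (group_gralg k G)).
Local Notation u := (@group_unit k G).
Local Notation iota := (group_algebra_map G).

Definition graded_klinear (P N : grMod grG) (s : P -> N) : Prop :=
  [/\ zmod_morphism s,
      forall c p, s ((iota c : grG) *: p) = (iota c : grG) *: s p
    & forall h p, grmod_piece h p -> grmod_piece h (s p)].

(** Since the restriction of modules from kG to k has an exact right adjoint,
    coinduction, a graded projective kG-module is projective for graded k-linear
    maps. *)
Lemma graded_klinear_lift (P N L : grMod grG) (d : grHom N L) (q : P -> L) :
  gr_projective P -> graded_klinear q -> (forall p, exists y, d y = q p) ->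
  exists2 s : P -> N, graded_klinear s & forall p, d (s p) = q p.
Proof.
move=> projP [qB qZ qp] q_im.
pose scN c (y : N) := (iota c : grG) *: y.
pose scL c (y : L) := (iota c : grG) *: y.
(* As d need not be surjective, the target is cut down to its image. *)
pose L_ h : set L := [set y | grmod_piece h y /\ exists x, d x = y].
have scNB c : zmod_morphism (scN c) by move=> y y'; apply: scalerBr.
have N_sc h c y : grmod_piece h y -> grmod_piece h (scN c y).
  exact: (@grmod_piece_map k G' grG N).
have L_sub h : subgroup_closed (L_ h).
  split=> [|y y' [Ly [x xy]] [Ly' [x' xy']]].
    split; first exact: (subgroup0 (grmod_sub _ _)).
    by exists 0; apply: (zmod_morphism0 (grhomB d)).
  split; first exact: (subgroupB (grmod_sub _ _) Ly Ly').
  by exists (x - x'); rewrite grhomB xy xy'.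
have [_ _ indN] := grmod_sum N; have [_ _ indL] := grmod_sum L.
have indL' : independent L_.
  by move=> s c us cL; apply: indL => // h; have [] := cL h.
have L_sc h c y : L_ h y -> L_ h (scL c y).
  move=> [Ly [x xy]]; split; first exact: (@grmod_piece_map k G' grG L).
  by exists (scN c x); rewrite linearZ xy.
have tr V (w : kG -> V) (a : kG) : setT w -> setT (fun b => w (b * a)) by [].
have cN := coind_pieceP phi scNB (@grmod_sub _ _ _ N) indN N_sc (conj Logic.I
  (fun _ _ _ _ => Logic.I)) (tr N).
have cL := coind_pieceP phi (fun c => scalerBr _ : zmod_morphism (scL c))
  L_sub indL' L_sc (conj Logic.I (fun _ _ _ _ => Logic.I)) (tr L).
have dZ c y : d (scN c y) = scL c (d y) by apply: linearZ.
have [|||s [sB ds sC]] := coind_lift projP cN cL (grhomB d) _ _ qB.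
- move=> t w [wB wZ wp _]; split=> // [b b'|c b|g].
  + by rewrite /= wB grhomB.
  + by rewrite /= wZ dZ.
  by split; [apply: grhom_piece|exists (w (u g))].
- move=> t w' [wB wZ wp _].
  have /choice[y yP] g : exists y, grmod_piece (phi g * t)%g y /\ d y = w' (u g).
    have [Lw [y yw]] := wp g.
    exists (component (@grmod_piece _ _ _ N) (phi g * t)%g y).
    split; first exact: component_piece (grmod_sum N) _ _.
    by rewrite -component_hom yw (component_id (grmod_sum L)).
  have [||||w [w_B w_Z wu]] := @group_algebra_free k G N scN y.
  + exact: scNB.
  + by move=> x c c'; rewrite /scN rmorphB scalerBl.
  + by move=> c c' x; rewrite /scN rmorphM scalerA.
  + by move=> x; rewrite /scN rmorph1 scale1r.
  exists w; first by split=> // g; rewrite wu; have [] := yP g.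
  apply: funext; apply: group_algebra_ext => // [b b'|c g].
    by rewrite /= w_B grhomB.
  by rewrite /= w_Z dZ wZ wu; have [_ ->] := yP g.
- move=> t p Pp; split=> // [b b'|c b|g].
  + by rewrite scalerBl qB.
  + by rewrite /scL -qZ scalerA.
  split; last exact: q_im.
  exact/qp/group_unit_scale.
exists s => //; split=> // [c p|h p Pp].
  move: p; apply: (homogeneous_ext (grmod_sum P)) => [p p'|p p'|t p Pp].
  - by rewrite scalerBr sB.
  - by rewrite sB scalerBr.
  by have [_ /(_ c 1) + _ _] := sC _ _ Pp; rewrite mulr1 scale1r.
have [_ _ /(_ 1%g) + _] := sC _ _ Pp.
by rewrite group_unit1 scale1r gmulf1 mul1g.
Qed.

(** One step of a contracting homotopy.  The relation e s e = e makes 1 - s e take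
    values in ker e = im d, so it lifts to s' with d s' = 1 - s e, and this gives
    d s' d = d: the condition of the next step, where s no longer appears. *)
Lemma splitting_step (P1 P0 M : grMod grG) (d : grHom P1 P0) (e : grHom P0 M)
    (s : M -> P0) :
  gr_projective P0 -> exact_at d e -> graded_klinear s ->
  (forall p, e (s (e p)) = e p) ->
  exists2 s' : P0 -> P1, graded_klinear s' & forall p, d (s' (d p)) = d p.
Proof.
move=> projP ex [sB sZ sp] es.
have [|p|s' s'P ds'] := @graded_klinear_lift P0 P1 P0 d (fun p => p - s (e p)) projP.
- split=> [p p'|c p|h p Pp].
  + by rewrite grhomB sB !opprD !opprK addrACA.
  + by rewrite linearZ sZ scalerBr.
  by apply: (subgroupB (grmod_sub _ _) Pp); apply/sp/grhom_piece.
- by apply/ex; rewrite grhomB es subrr.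
exists s' => // p; rewrite ds'.
have -> : e (d p) = 0 by apply/ex; exists p.
by rewrite (zmod_morphism0 sB) subr0.
Qed.

(** The two actions of k on kG' agree, through kG and through kG'. *)
Lemma target_scale (c : k) (y : target_group_module k phi) :
  ((iota c : kG) *: y : group_algebra k G')
    = group_algebra_map G' c * (y : group_algebra k G').
Proof. by rewrite [LHS]convEr [RHS]convEr; under eq_bigr do rewrite convUU gmulf1;
  under [RHS]eq_bigr do rewrite convUU. Qed.

(** The k-module kG' is free on G', so a section of e is given by a choice of
    homogeneous preimages of the elements of G'. *)
Lemma splitting_base (P : grMod grG) (e : grHom P (target_group_grmod k phi)) :
  (forall y, exists p, e p = y) ->
  exists2 s : target_group_grmod k phi -> P, graded_klinear s
    & forall y, e (s y) = y.
Proof.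
move=> e_surj.
have /choice[y yP] (h : G') : exists y, grmod_piece h y /\ e y = @group_unit k G' h.
  have [y yh] := e_surj (@group_unit k G' h).
  exists (component (@grmod_piece _ _ _ P) h y).
  split; first exact: component_piece (grmod_sum P) _ _.
  rewrite -component_hom yh.
  by apply: (component_id (@target_group_sum k G G' phi)); exists 1.
pose sc c (y : P) := (iota c : grG) *: y.
have [||||s [sB sZ su]] := @group_algebra_free k G' P sc y.
- by move=> c x x'; apply: scalerBr.
- by move=> x c c'; rewrite /sc rmorphB scalerBl.
- by move=> c c' x; rewrite /sc rmorphM scalerA.
- by move=> x; rewrite /sc rmorph1 scale1r.
exists s; first split=> // [c z|h _ [c ->]].
- exact: etrans (congr1 s (target_scale c z)) (sZ c z).
- rewrite group_monomialE sZ su; apply: (@grmod_piece_map k G' grG P).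
  by have [] := yP h.
apply: (group_algebra_ext (w := e \o s) (w' := idfun)) => // [b b'|c h].
  by rewrite /= sB grhomB.
rewrite /= sZ su /sc linearZ; have [_ ->] := yP h.
exact: target_scale.
Qed.

End Splitting.

(** * The injective resolution *)

Section Resolution.
Variables (k : comPzRingType) (G G' : groupType).
Variables (phi : UMagmaMorphism.type G G') (A : grAlg k G).
Local Notation kG := (group_algebra k G).
Local Notation grG := (push_alg phi (group_gralg k G)).
Local Notation B := (push_alg phi A).
Local Notation A_ := (@gralg_piece k G A).
Local Notation u := (@group_unit k G).
Local Notation iota := (group_algebra_map G).
Variable X : grMod B.
Local Notation Hom P := (internal_hom P X).
Local Notation kG' := (target_group_grmod k phi).

Section Precomposition.
Variables (P N : grMod grG) (d : grHom P N).

Definition precomp (y : Hom N) : P -> X := span_val y \o d.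

Lemma precompB : zmod_morphism precomp. Proof. by []. Qed.

Lemma precompZ (a : A) y : precomp ((a : B) *: y) = hom_op a (precomp y).
Proof.
apply: funext => p; move: a.
apply: (homogeneous_ext (gralg_sum A)) => [a b|a b|g a Aa].
- exact: hom_opB.
- exact: hom_opB.
by rewrite (hom_opE _ _ Aa) [LHS](hom_opE _ _ Aa) /precomp /= linearZ.
Qed.

Lemma precomp_piece h y : grmod_piece h y -> khom_piece h (precomp y).
Proof.
move=> [[yB yp] yZ]; split=> [|c p]; last by rewrite /precomp /= linearZ yZ.
split=> [p p'|h' p Pp]; first by rewrite /precomp /= grhomB yB.
by apply: yp; apply: grhom_piece.
Qed.

Definition hom_map : grHom (Hom N) (Hom P) :=
  span_hom (F := hom_family P X) precompB precompZ precomp_piece.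

Lemma hom_map_injective : (forall y, exists p, d p = y) -> injective hom_map.
Proof.
move=> d_surj y y' yy'; apply: span_val_inj; apply: funext => z.
have [p <-] := d_surj z.
exact: (congr1 (fun v : Hom P => span_val v p) yy').
Qed.

End Precomposition.

(** A map y on P0 that vanishes on im d = ker e factors through the image of e;
    the splitting s extends this factorization to all of M, as y s. *)
Lemma hom_map_exact (P1 P0 M : grMod grG) (d : grHom P1 P0) (e : grHom P0 M)
    (s : M -> P0) :
  exact_at d e -> graded_klinear s -> (forall p, e (s (e p)) = e p) ->
  exact_at (hom_map e) (hom_map d).
Proof.
move=> ex [sB sZ sp] es y; split=> [dy0|[z <-]]; last first.
  apply: span_val_inj; apply: funext => p; rewrite /= /precomp /=.
  have -> : e (d p) = 0 by apply/ex; exists p.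
  exact: (zmod_morphism0 (internal_hom_additive z)).
have Sys : internal_sum (@fam_piece _ _ _ (hom_family M X)) setT (span_val y \o s).
  move: {dy0} (span_val y) (span_valP y); apply: span_ind.
    have sub := span_set_sub (hom_family M X).
    split=> [|z z' Sz Sz']; first exact: (subgroup0 sub).
    exact: (subgroupB sub Sz Sz').
  move=> h z [[zB zp] zZ]; apply: (internal_sum1 (i := h) (@fam_sub _ _ _ _)) => //.
  split=> [|c p]; last by rewrite /= sZ zZ.
  by split=> [p p'|h' p Pp]; [rewrite /= sB zB|apply/zp/sp].
exists (span_elt Sys); apply: span_val_inj; apply: funext => p /=.
rewrite /precomp /=; apply/eqP; rewrite -subr_eq0 -internal_hom_additive.
have [q <-] : exists q, d q = s (e p) - p by apply/ex; rewrite grhomB es subrr.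
exact/eqP/(congr1 (fun v : Hom P1 => span_val v q) dy0).
Qed.

Lemma internal_hom_zero (P : grMod grG) : is_zero P -> is_zero (Hom P).
Proof.
move=> P0 y; apply: span_val_inj; apply: funext => p; rewrite (P0 p).
exact: (zmod_morphism0 (internal_hom_additive y)).
Qed.

(** The isomorphism of X with the internal Hom out of kG': x corresponds to the
    k-linear map that sends the group element h to the component of x of degree
    h. *)
Definition unit_map (x : X) (y : group_algebra k G') : X :=
  extend (grmod_sum X) (fun h z => (kalg_map A (mcoeff h y) : B) *: z) x.

Lemma unit_mapB y : zmod_morphism (unit_map^~ y).
Proof. by apply: extendB => h z z'; rewrite scalerBr. Qed.

Lemma unit_mapE h x y : grmod_piece h x ->
  unit_map x y = (kalg_map A (mcoeff h y) : B) *: x.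
Proof.
by move=> Xx; rewrite /unit_map (extend_piece _ _ Xx) // => l z z'; rewrite scalerBr.
Qed.

Lemma unit_map_additive x : zmod_morphism (unit_map x).
Proof.
move=> y y'; move: x; apply: (homogeneous_ext (grmod_sum X)) => [x x'|x x'|h x Xx].
- by rewrite unit_mapB.
- by rewrite !unit_mapB !opprD !opprK addrACA.
by rewrite !(unit_mapE _ Xx) mcoeffB rmorphB scalerBl.
Qed.

Lemma unit_map_unit h x :
  unit_map x (group_unit k h) = component (@grmod_piece _ _ _ X) h x.
Proof.
have Xs := grmod_sum X.
move: x; apply: (homogeneous_ext Xs) => [x x'|x x'|l x Xx].
- exact: unit_mapB.
- exact: componentB.
rewrite (unit_mapE _ Xx) mcoeffU; case: eqP => [->|/eqP hl].
  by rewrite (component_id Xs) // rmorph1 scale1r.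
by rewrite (component_neq Xs Xx) // rmorph0 scale0r.
Qed.

Lemma unit_map_klinear x c y :
  unit_map x (group_algebra_map G' c * y) = (kalg_map A c : B) *: unit_map x y.
Proof.
have mcoeffM l : mcoeff l (group_algebra_map G' c * y) = c * mcoeff l y.
  move: y; apply: group_algebra_ext => [y y'|y y'|d h].
  - by rewrite mulrBr mcoeffB.
  - by rewrite mcoeffB mulrBr.
  by rewrite mulrA -rmorphM -!group_monomialE !mcoeffU mulrnAr.
move: x; apply: (homogeneous_ext (grmod_sum X)) => [x x'|x x'|h x Xx].
- exact: unit_mapB.
- by rewrite unit_mapB scalerBr.
by rewrite !(unit_mapE _ Xx) mcoeffM rmorphM scalerA.
Qed.

Lemma unit_mapZ (a : A) x :
  (unit_map ((a : B) *: x) : kG' -> X) = hom_op a (unit_map x : kG' -> X).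
Proof.
apply: funext => y; move: a; apply: (homogeneous_ext (gralg_sum A)) => [a b|a b|g a Aa].
- by rewrite scalerBl unit_mapB.
- exact: hom_opB.
rewrite (hom_opE _ _ Aa); move: y; apply: group_algebra_ext => [y y'|y y'|c h].
- exact: unit_map_additive.
- by rewrite scalerBr unit_map_additive scalerBr.
have -> : ((u g^-1 : grG) *: (group_algebra_map G' c * group_unit k h : kG') : kG')
    = group_algebra_map G' c * group_unit k (phi g^-1 * h)%g.
  by rewrite -!group_monomialE [LHS]target_group_scaleU mul1r.
rewrite !unit_map_klinear !unit_map_unit !scalerA.
have -> : h = (phi g * (phi g^-1 * h))%g by rewrite mulgA -gmulfM mulgV gmulf1 mul1g.
rewrite (component_scale _ _ (push_piece_alg phi Aa)) scalerA.
by rewrite mulgA -gmulfM mulVg gmulf1 mul1g kalg_central.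
Qed.

Lemma unit_map_piece h x : grmod_piece h x ->
  khom_piece (P := kG') h (unit_map x : kG' -> X).
Proof.
move=> Xx; split=> [|c y]; last first.
  by move: (congr1 (unit_map x) (target_scale c y)); rewrite unit_map_klinear.
split=> [y y'|h' _ [c ->]]; first exact: unit_map_additive.
rewrite group_monomialE unit_map_klinear unit_map_unit.
case: eqP => [->|/eqP hh'].
  by apply: grmod_piece_map; apply: component_piece (grmod_sum X) _ _.
by rewrite (component_neq (grmod_sum X) Xx) ?scaler0.
Qed.

Definition unit_hom : grHom X (Hom kG') :=
  span_hom (F := hom_family kG' X) (fun x x' => funext (fun y => unit_mapB y x x'))
    unit_mapZ unit_map_piece.

Lemma unit_hom_injective : injective unit_hom.
Proof.
move=> x x' xx'; apply: (component_inj (grmod_sum X)) => h.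
rewrite -!unit_map_unit.
exact: (congr1 (fun v : Hom kG' => span_val v (group_unit k h : kG')) xx').
Qed.

Lemma unit_hom_surjective y : exists x, unit_hom x = y.
Proof.
move: y; apply: (homogeneous_ind (span_sum (hom_family kG' X))).
  split=> [|_ _ [x <-] [x' <-]]; last by exists (x - x'); rewrite grhomB.
  by exists 0; rewrite (zmod_morphism0 (grhomB unit_hom)).
move=> h y [[yB yp] yZ]; exists (span_val y (group_unit k h : kG')).
apply: span_val_inj; apply: funext; apply: group_algebra_ext => [z z'||c l] //.
  exact: unit_map_additive.
have Gu l' : @grmod_piece _ _ _ kG' l' (group_unit k l' : kG') by exists 1.
have yc : span_val y (group_algebra_map G' c * group_unit k l : group_algebra k G')
    = (kalg_map A c : B) *: span_val y (group_unit k l : kG').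
  exact: etrans (congr1 (span_val y) (esym (target_scale c _))) (yZ c _).
rewrite yc [LHS]unit_map_klinear unit_map_unit; congr (_ *: _).
have := yp _ _ (Gu h); rewrite eqxx => Xyh.
have := yp _ _ (Gu l); case: eqP => [-> _|/eqP lh ->].
  exact: component_id (grmod_sum X) _ _ Xyh.
exact: component_neq (grmod_sum X) _ _ _ Xyh lh.
Qed.

End Resolution.

Lemma grhom_comp (k : comPzRingType) (H : groupType) (C : grAlg k H) (L M N : grMod C)
    (f : grHom M N) (g : grHom L M) : exists h : grHom L N, forall x, h x = f (g x).
Proof.
have lin : linear (f \o g) by move=> a x y; rewrite /= !linearP.
pose fg : {linear L -> N} :=
  HB.pack (f \o g : L -> N) (GRing.isLinear.Build C L N _ (f \o g) lin).
by exists (@GrHom k H C L N fg (fun h x Lx => grhom_piece f (grhom_piece g Lx))).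
Qed.

Lemma least_or_infinity_le (Q R : nat -> Prop) : (forall n, R n -> Q n) ->
  dim_le (least_or_infinity Q) (least_or_infinity R).
Proof.
move=> RQ; rewrite /least_or_infinity.
case: (pselect (exists n, `[< R n >])) => [exR|noR]; last by case: pselect.
case: (ex_minnP exR) => n /asboolP/RQ Qn _.
case: pselect => [exQ|[]]; last by exists n; apply/asboolP.
by case: ex_minnP => m _; apply; apply/asboolP.
Qed.

Section Comparison.
Variables (k : comPzRingType) (G G' : groupType).
Variables (phi : UMagmaMorphism.type G G') (A : grAlg k G) (I : grMod A).
Hypotheses (noethA : noetherian A) (injI : gr_injective I).
Local Notation kG' := (target_group_grmod k phi).
Local Notation X := (push_mod phi I).

Lemma injective_resolution_push n :
  projective_resolution_of_length kG' n -> injective_resolution_of_length X n.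
Proof.
move=> [P [e [d [projP P0 e_surj ex0 ex]]]].
have [s0 s0P es0] := splitting_base e_surj.
have es0e p : e (s0 (e p)) = e p by [].
have split i : exists2 s : P i -> P i.+1, graded_klinear s
    & forall p, d i (s (d i p)) = d i p.
  elim: i => [|i [s sP ds]]; first exact: splitting_step ex0 s0P es0e.
  exact: splitting_step (ex i) sP ds.
have [eps epsE] := grhom_comp (hom_map X e) (unit_hom X).
exists (fun i => internal_hom (P i) X), eps, (fun i => hom_map X (d i)).
split=> [i|i /P0|x x'||i].
- exact: internal_hom_injective.
- exact: internal_hom_zero.
- rewrite !epsE => /(hom_map_injective e_surj); exact: unit_hom_injective.
- move=> y; rewrite (hom_map_exact ex0 s0P es0e y).
  split=> [[z <-]|[x <-]]; last by exists (unit_hom X x); rewrite epsE.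
  by have [x <-] := unit_hom_surjective z; exists x.
have [s sP ds] := split i.
exact: hom_map_exact (ex i) sP ds.
Qed.

End Comparison.

Theorem theorem3p3 (k : comPzRingType) (G G' : groupType)
    (phi : UMagmaMorphism.type G G') (A : grAlg k G)
    (projA : @projective_module k (kmodule A)) (noethA : noetherian A)
    (I : grMod A) (injI : gr_injective I) :
  dim_le (injective_dimension (push_mod phi I))
         (projective_dimension (target_group_grmod k phi)).
Proof.
by apply: least_or_infinity_le => n; apply: injective_resolution_push.
Qed.
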